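(* Let $H$, $A$, $m$ be as in the context. Then the following hold. (1) (Analytic data) Let $r_0>0$ be real and let $\varphi(\sigma):=r_0\sigma$ for every $\sigma\ge0$. Let $(u_0,u_1)\in\mathcal{G}_{\varphi,3/4}(A)\times\mathcal{G}_{\varphi,1/4}(A)$ and let $u$ be the global solution to $$u''(t)+m\left(|A^{1/2}u(t)|^2\right)Au(t)=0,\qquad u(0)=u_0,\quad u'(0)=u_1.$$ Then there exists a positive real number $\beta_1$ such that the energy $F_\varphi$ (defined in the context) satisfies $$F_\varphi(t)\le F_\varphi(0)\exp(\exp(\beta_1t))\qquad\forall t\ge0.$$ Moreover (with the same $\beta_1$), for every real $\alpha\ge0$ there exists a positive real number $B_{1,\alpha}$ such that $$|A^\alpha u'(t)|^2+|A^{\alpha+1/2}u(t)|^2\le B_{1,\alpha}\exp(4\alpha\beta_1t)\qquad\forall t\ge0.$$ (2) (Classical quasi-analytic data) Let $\varphi(\sigma):=\dfrac{\sigma}{\log(2+\sigma)}$ for every $\sigma\ge0$. Let $(u_0,u_1)\in\mathcal{G}_{\varphi,3/4}(A)\times\mathcal{G}_{\varphi,1/4}(A)$ and let $u$ be the global solution to the same problem. Then there exists a positive real number $\beta_2$ such that $$F_\varphi(t)\le F_\varphi(0)\exp(\exp(\exp(\beta_2t)))\qquad\forall t\ge0.$$ Moreover (with the same $\beta_2$), for every real $\alpha\ge0$ there exists a positive real number $B_{2,\alpha}$ such that $$|A^\alpha u'(t)|^2+|A^{\alpha+1/2}u(t)|^2\le B_{2,\alpha}\exp\left(\exp\left(\max\{2,4\alpha\}\beta_2t\right)\right)\qquad\forall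 t\ge0.$$
   Context: Standing assumptions. $H$ is a real Hilbert space with norm $|\cdot|$ and inner product $\langle\cdot,\cdot\rangle$. $A$ is a self-adjoint operator on $H$ with domain $D(A)$ for which there are an orthonormal basis $\{e_k\}_{k\ge1}$ of $H$ and a sequence $\{\lambda_k\}$ of nonnegative reals with $Ae_k=\lambda_k^2e_k$ for all $k$. For $\alpha\ge0$, $D(A^\alpha)=\{z\in H:\sum_k\lambda_k^{4\alpha}\langle z,e_k\rangle^2<\infty\}$ and $A^\alpha z=\sum_k\lambda_k^{2\alpha}\langle z,e_k\rangle e_k$. The function $m:[0,+\infty)\to\mathbb{R}$ is of class $C^1$ and there is a constant $\nu_0>0$ with $m(\sigma)\ge\nu_0$ for all $\sigma\ge0$. Generalized Sobolev–Gevrey spaces. For $\alpha\ge0$ and $\varphi:[0,+\infty)\to\mathbb{R}$, $\mathcal{G}_{\varphi,\alpha}(A)$ is the set of $z\in H$ with $\sum_{k=1}^\infty\lambda_k^{4\alpha}\exp(\varphi(\lambda_k))\langle z,e_k\rangle^2<+\infty$. Solutions are functions in $C^0([0,T],D(A^{3/4}))\cap C^1([0,T],D(A^{1/4}))$ (for every $T>0$ if global) satisfying the equation componentwise: $u_k''+m(|A^{1/2}u(t)|^2)\lambda_k^2u_k=0$ with $u_k=\langle u,e_k\rangle$. Along solutions $|u'(t)|^2+\int_0^{|A^{1/2}u(t)|^2}m(s)\,ds$ is constant. Energy. For a solution $u$ define the corrected $\varphi$-energy $$F_\varphi(t):=\sum_{k=1}^\infty\max\{1,\lambda_k\}\,a_k(t)\,\exp(\varphi(\lambda_k)),\quad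 a_k(t):=\langle u'(t),e_k\rangle^2+m\left(|A^{1/2}u(t)|^2\right)\lambda_k^2\langle u(t),e_k\rangle^2.$$ Known result (previous literature). Let $\varphi:[0,+\infty)\to[0,+\infty)$ be increasing and continuous with $\varphi(0)=0$ and $\int_1^{+\infty}\varphi(\sigma)\sigma^{-2}\,d\sigma=+\infty$ (both choices of $\varphi$ in the theorem qualify). Then for every $(u_0,u_1)\in\mathcal{G}_{\varphi,3/4}(A)\times\mathcal{G}_{\varphi,1/4}(A)$ the problem has a unique global solution, which belongs to $C^0([0,+\infty),\mathcal{G}_{\varphi,3/4}(A))\cap C^1([0,+\infty),\mathcal{G}_{\varphi,1/4}(A))$; and if $|u_1|^2+|A^{1/2}u_0|^2>0$ there are real constants $c_0$ and $c_1>0$ with $F_\varphi(t)\ge c_1$ and $F_\varphi'(t)\le c_0F_\varphi(t)\{1+\varphi^{-1}(\log(F_\varphi(t)/c_1))\}$ for all $t\ge0$. *)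

(* Defs.v *)
From HB Require Import structures.
From mathcomp Require Import all_boot all_order all_algebra.
From mathcomp Require Import all_classical all_reals all_analysis.

Set Implicit Arguments.
Unset Strict Implicit.
Unset Printing Implicit Defensive.

Import Order.TTheory GRing.Theory Num.Theory.
Import numFieldNormedType.Exports.

Local Open Scope classical_set_scope.
Local Open Scope ring_scope.

(* With [dot] bilinear, symmetric and positive definite by its type, this makes
   the complete normed module [H] a real Hilbert space. *)
Definition hilbert_dot (R : realType) (H : completeNormedModType R)
    (dot : {dot H for idfun}) : Prop :=
  forall x : H, `|x| ^+ 2 = dot x x.

(* An unbounded operator is a total function [A] considered only on its domain
   [DA]. *)
Definition adjoint_graph (R : realType) (H : completeNormedModType R)
    (dot : {dot H for idfun}) (DA : set H) (A : H -> H) : set (H * H) :=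
  [set yz | forall x, DA x -> dot (A x) yz.1 = dot x yz.2].

Definition self_adjoint (R : realType) (H : completeNormedModType R)
    (dot : {dot H for idfun}) (DA : set H) (A : H -> H) : Prop :=
  [/\ DA 0,
      (forall (c : R) x y, DA x -> DA y ->
         DA (c *: x + y) /\ A (c *: x + y) = c *: A x + A y),
      dense DA &
      adjoint_graph dot DA A = [set yz | DA yz.1 /\ A yz.1 = yz.2]].

(* The index [k >= 1] of the mathematical text is [k : nat], starting at 0. *)
Definition orthonormal_basis (R : realType) (H : completeNormedModType R)
    (dot : {dot H for idfun}) (e : nat -> H) : Prop :=
  (forall i j, dot (e i) (e j) = (i == j)%:R) /\
  (forall z, series (fun k => dot z (e k) *: e k) @ \oo --> z).

(* In the following, the powers of A are those of the operator with
   A e_k = lam_k ^ 2 e_k. Note that 0 `^ 0 = 1, so that the power of exponent 0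
   is the identity of H even if some lam_k is 0. *)
Definition power_dom (R : realType) (H : completeNormedModType R)
    (dot : {dot H for idfun}) (e : nat -> H) (lam : nat -> R) (alpha : R)
    : set H :=
  [set z | (\sum_(k <oo)
    (lam k `^ (4 * alpha) * dot z (e k) ^+ 2)%:E < +oo)%E].

(* Meaningful on [power_dom dot e lam alpha] only. *)
Definition power_op (R : realType) (H : completeNormedModType R)
    (dot : {dot H for idfun}) (e : nat -> H) (lam : nat -> R) (alpha : R)
    (z : H) : H :=
  lim (series (fun k => (lam k `^ (2 * alpha) * dot z (e k)) *: e k) @ \oo).

Definition gevrey (R : realType) (H : completeNormedModType R)
    (dot : {dot H for idfun}) (e : nat -> H) (lam : nat -> R)
    (phi : R -> R) (alpha : R) : set H :=
  [set z | (\sum_(k <oo)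
    (lam k `^ (4 * alpha) * expR (phi (lam k)) * dot z (e k) ^+ 2)%:E
      < +oo)%E].

Definition graph_norm (R : realType) (H : completeNormedModType R)
    (dot : {dot H for idfun}) (e : nat -> H) (lam : nat -> R) (alpha : R)
    (z : H) : R :=
  Num.sqrt (`|z| ^+ 2 + `|power_op dot e lam alpha z| ^+ 2).

Definition diff_quot (R : realType) (V : normedModType R) (f : R -> V)
    (t s : R) : V := (s - t)^-1 *: (f s - f t).

(* Derivative relative to [I]: one-sided at the endpoints of an interval. *)
Definition derivable_on (R : realType) (V : normedModType R) (I : set R)
    (f : R -> V) (t : R) : Prop :=
  cvg (diff_quot f t s @[s --> within I t^']).

Definition derive_on (R : realType) (V : normedModType R) (I : set R)
    (f : R -> V) (t : R) : V :=
  lim (diff_quot f t s @[s --> within I t^']).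

Definition C1_real (R : realType) (I : set R) (f : R -> R) : Prop :=
  (forall t, I t -> derivable_on I (f : R -> R^o) t) /\
  {within I, continuous (derive_on I (f : R -> R^o) : R -> R^o)}.

(* C^0(I, D(A^alpha)) and C^1(I, D(A^alpha)), where D(A^alpha) carries the
   graph norm. *)
Definition C0_dom (R : realType) (H : completeNormedModType R)
    (dot : {dot H for idfun}) (e : nat -> H) (lam : nat -> R)
    (I : set R) (alpha : R) (f : R -> H) : Prop :=
  forall t, I t ->
    power_dom dot e lam alpha (f t) /\
    graph_norm dot e lam alpha (f s - f t) @[s --> within I (nbhs t)]
      --> (0 : R).

Definition C1_dom (R : realType) (H : completeNormedModType R)
    (dot : {dot H for idfun}) (e : nat -> H) (lam : nat -> R)
    (I : set R) (alpha : R) (f : R -> H) : Prop :=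
  [/\ C0_dom dot e lam I alpha f,
      C0_dom dot e lam I alpha (derive_on I f) &
      forall t, I t ->
        graph_norm dot e lam alpha (diff_quot f t s - derive_on I f t)
          @[s --> within I t^'] --> (0 : R)].

Definition half_line (R : realType) : set R := `[0, +oo[%classic.
Arguments half_line {R}.

Definition coef (R : realType) (H : completeNormedModType R)
    (dot : {dot H for idfun}) (e : nat -> H) (u : R -> H) (k : nat)
    : R -> R^o := fun t => dot (u t) (e k).

(* m(|A^(1/2) u(t)|^2) *)
Definition speed (R : realType) (H : completeNormedModType R)
    (dot : {dot H for idfun}) (e : nat -> H) (lam : nat -> R) (m : R -> R)
    (u : R -> H) (t : R) : R :=
  m (`|power_op dot e lam (1 / 2) (u t)| ^+ 2).

(* u'' + m(|A^(1/2) u|^2) A u = 0 on [0, +oo[, componentwise. Only the values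
   of [u] on [0, +oo[ matter. *)
Definition global_solution (R : realType) (H : completeNormedModType R)
    (dot : {dot H for idfun}) (e : nat -> H) (lam : nat -> R) (m : R -> R)
    (u0 u1 : H) (u : R -> H) : Prop :=
  [/\ C0_dom dot e lam half_line (3 / 4) u,
      C1_dom dot e lam half_line (1 / 4) u,
      (forall k t, half_line t ->
         let uk := coef dot e u k in
         [/\ derivable_on half_line uk t,
             derivable_on half_line (derive_on half_line uk) t &
             derive_on half_line (derive_on half_line uk) t
               + speed dot e lam m u t * lam k ^+ 2 * uk t = 0]),
      u 0 = u0 &
      derive_on half_line u 0 = u1].

Definition mode_energy (R : realType) (H : completeNormedModType R)
    (dot : {dot H for idfun}) (e : nat -> H) (lam : nat -> R) (m : R -> R)
    (u : R -> H) (k : nat) (t : R) : R :=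
  dot (derive_on half_line u t) (e k) ^+ 2
  + speed dot e lam m u t * lam k ^+ 2 * dot (u t) (e k) ^+ 2.

(* The terms are nonnegative for t >= 0, so the sum always exists in
   [0, +oo]. *)
Definition phi_energy (R : realType) (H : completeNormedModType R)
    (dot : {dot H for idfun}) (e : nat -> H) (lam : nat -> R) (m : R -> R)
    (phi : R -> R) (u : R -> H) (t : R) : \bar R :=
  (\sum_(k <oo) (Num.max 1 (lam k) * mode_energy dot e lam m u k t
                 * expR (phi (lam k)))%:E)%E.

(* |A^alpha u'(t)|^2 + |A^(alpha+1/2) u(t)|^2 <= b, both norms being defined *)
Definition sobolev_bound (R : realType) (H : completeNormedModType R)
    (dot : {dot H for idfun}) (e : nat -> H) (lam : nat -> R)
    (alpha : R) (u : R -> H) (t b : R) : Prop :=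
  [/\ power_dom dot e lam alpha (derive_on half_line u t),
      power_dom dot e lam (alpha + 1 / 2) (u t) &
      `|power_op dot e lam alpha (derive_on half_line u t)| ^+ 2
      + `|power_op dot e lam (alpha + 1 / 2) (u t)| ^+ 2 <= b].

(* Main.v *)
Require Import Defs.
From HB Require Import structures.
From mathcomp Require Import all_boot all_order all_algebra.
From mathcomp Require Import all_classical all_reals all_analysis.
From mathcomp Require Import ring lra.

Set Implicit Arguments.
Unset Strict Implicit.
Unset Printing Implicit Defensive.

Import Order.TTheory GRing.Theory Num.Theory.
Import numFieldNormedType.Exports.

Local Open Scope classical_set_scope.
Local Open Scope ring_scope.

(** Write a_k for the energy of the k-th mode, c = m(|A^(1/2) u|^2) for the
    propagation speed and S = sum_k lam_k a_k. Along a solution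
    a_k' = c' lam_k^2 u_k^2, and c' is a bounded multiple of
    <A^(3/4) u, A^(1/4) u'>, which is at most a multiple of S. So every mode
    obeys a_k' <= C S a_k with one and the same constant C. If L is the
    primitive of C S with L(0) = 0, then a_k(t) <= a_k(0) exp(L(t)) for all k,
    hence F_phi(t) <= F_phi(0) exp(L(t)) for every weight phi
    ([kirchhoff_energy_estimate], [phi_energy_le]).

    It remains to bound L. Cut S at a frequency mu. The low modes contribute at
    most mu E0, where E0 bounds sum_k a_k; the high ones contribute at most
    exp(L - phi(mu)) F_phi(0). Choosing mu = T(L) with phi(T(L)) >= L gives the
    differential inequality L' <= C (T(L) E0 + F_phi(0)) ([weighted_sum_le]).
    For phi(sigma) = r0 sigma one takes T linear, and L grows at most
    exponentially; for phi(sigma) = sigma / log(2 + sigma) one takes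
    T(x) = 5 (2 + x) log(2 + x), and log(2 + L) grows at most exponentially.
    Cutting sum_k lam_k^(4 alpha) a_k at the frequency T(2 L) instead, one half
    of phi absorbs the polynomial weight and the other half absorbs exp(L),
    which gives the bounds on the norms of A^alpha u' and A^(alpha + 1/2) u
    ([moment_sum_le]).

    The constant C exists only because |A^(1/2) u| stays bounded, that is,
    because of the energy inequality [energy_nonincreasing]. The solution is
    too rough for |u'|^2 to be differentiated directly. The kinetic energy of
    the first n modes is differentiated instead; the error is the tail of the
    series defining S, and on a bounded time interval that tail is uniformly
    small, since a_k(t) is there at most a constant times a_k(0)
    ([local_tail_bound]).

    All of this concerns sequences of scalar functions, collected in
    [modal_flow]; the Hilbert space enters through Parseval's identity, which
    produces such sequences from a solution ([kirchhoff_modal_flow]). *)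

(** * Real functions of one variable *)

Lemma is_derive_continuous (R : realType) (f : R -> R) (df t : R) :
  is_derive t 1 f df -> {for t, continuous f}.
Proof.
by move=> [df' _]; apply: differentiable_continuous; apply/derivable1_diffP.
Qed.

(** The integral is taken from -1, so that the derivative at 0 is two-sided. *)
Lemma exists_primitive (R : realType) (f : R -> R) :
  continuous f ->
  exists2 F : R -> R, F 0 = 0 & forall x : R, 0 <= x -> is_derive x 1 F (f x).
Proof.
move=> cf; pose G x := (\int[lebesgue_measure]_(t in `[(-1 : R), x]) f t)%R.
exists (fun x => G x - G 0); first by rewrite subrr.
move=> x x0.
have [||||dG G'x] := @continuous_FTC1_closed R f (-1) x (x + 1).
- by rewrite ltrDl.
- apply: continuous_compact_integrable; first exact: segment_compact.
  by apply: continuous_subspaceT.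
- by apply: lt_le_trans x0; rewrite oppr_lt0.
- exact: cf.
have dGx : is_derive x 1 G (f x) by split => //; rewrite -derive1E.
by rewrite -[f x]subr0; apply: is_deriveB.
Qed.

Lemma deriv_ge0_le (R : realType) (f df : R -> R) (T : R) :
  0 <= T -> (forall t : R, 0 <= t <= T -> {for t, continuous f}) ->
  (forall t : R, 0 < t < T -> is_derive t 1 f (df t)) ->
  (forall t : R, 0 < t < T -> 0 <= df t) -> f 0 <= f T.
Proof.
rewrite le_eqVlt => /predU1P[<- //|T0] cf dfE df0.
have dI (x : R) : x \in `]0, T[%R -> is_derive x 1 f (df x).
  by rewrite in_itv/=; exact: dfE.
have cI : {within `[0, T], continuous f}.
  by apply: continuous_in_subspaceT => x /set_mem /=; rewrite in_itv/=; exact: cf.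
have [c + fE] := MVT T0 dI cI.
rewrite in_itv/= => /df0 dfc0.
by rewrite -subr_ge0 fE subr0 mulr_ge0// ltW.
Qed.

(** The product of [a] and exp(- b) is nonincreasing. *)
Lemma gronwall (R : realType) (a da b db : R -> R) (T : R) :
  0 <= T ->
  (forall t : R, 0 <= t <= T -> {for t, continuous a}) ->
  (forall t : R, 0 <= t <= T -> {for t, continuous b}) ->
  (forall t : R, 0 < t < T -> is_derive t 1 a (da t)) ->
  (forall t : R, 0 < t < T -> is_derive t 1 b (db t)) ->
  (forall t : R, 0 < t < T -> da t <= db t * a t) ->
  a T <= a 0 * expR (b T - b 0).
Proof.
move=> T0 ca cb daE dbE dab.
pose f t := - (a t * expR (- b t)).
have : f 0 <= f T.
  apply: (@deriv_ge0_le _ f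
    (fun t => - (a t * (expR (- b t) * - db t) + expR (- b t) * da t))) => //.
  - move=> t tT; apply: cvgN; apply: cvgM; first exact: ca.
    apply: (continuous_comp (f := fun t => - b t)); last exact: continuous_expR.
    by apply: cvgN; exact: cb.
  - move=> t tT; apply: is_deriveN; apply: is_deriveM; first exact: daE.
    apply: (is_derive1_comp (f := expR) (g := fun t => - b t)).
    by apply: is_deriveN; exact: dbE.
  - move=> t tT; rewrite mulrN mulrN opprD opprK mulrCA -mulrBr.
    by rewrite mulr_ge0 ?expR_ge0// subr_ge0 mulrC dab.
rewrite /f lerN2 !expRN ler_pdivrMr ?expR_gt0// mulrAC => /le_trans; apply.
by rewrite expRD expRN mulrA mulrAC.
Qed.

Lemma continuous_bounded_itv (R : realType) (f : R -> R) (T : R) :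
  continuous f -> exists2 K : R, 0 < K & forall t : R, 0 <= t <= T -> `|f t| <= K.
Proof.
move=> cf.
have cpt : compact (f @` `[0, T]).
  apply: continuous_compact; last exact: segment_compact.
  exact: continuous_subspaceT.
have [M [_ HM]] := compact_bounded cpt.
exists (Num.max 1 (M + 1)); first by rewrite lt_max ltr01.
move=> t tT; apply: (HM (Num.max 1 (M + 1))).
  by rewrite lt_max ltrDl ltr01 orbT.
by exists t => //=; rewrite in_itv.
Qed.

(** * Calculus on the closed half-line *)

Section HalfLine.
Context {R : realType}.
Implicit Types (V : normedModType R) (t : R).

Lemma half_lineE t : half_line t = (0 <= t).
Proof. by rewrite /half_line /= in_itv/= andbT. Qed.

Lemma half_line_dnbhs_proper t : 0 <= t -> ProperFilter (within half_line t^').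
Proof.
move=> t0; apply: Build_ProperFilter => tP.
have : \forall s \near t^'+, False.
  have tP' : \forall s \near t, s != t -> half_line s -> False := tP.
  apply: filterS tP' => s sP ts.
  by apply: sP; [rewrite gt_eqF|rewrite half_lineE ltW// (le_lt_trans t0)].
by move/filter_ex => [].
Qed.

(** A function on the half-line is turned into one on the whole line by
    composition with the retraction x |-> max(0, x); continuity and
    derivatives at positive times are then the ordinary two-sided ones. *)
Lemma cvg_maxr0_within (x : R) :
  Num.max 0 y @[y --> x] --> within half_line (nbhs (Num.max 0 x)).
Proof.
move=> B /= nB.
have cmax : Num.max 0 y @[y --> x] --> Num.max 0 x.
  by apply: continuous_max; [exact: cvg_cst|exact: cvg_id].
have : \forall y \near x, half_line (Num.max 0 y) -> B (Num.max 0 y).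
  exact: (cmax _ nB).
rewrite /nbhs/=; apply: filterS => y; apply.
by rewrite half_lineE le_max lexx.
Qed.

Lemma within_cvg_continuous (T : topologicalType) (f : R -> T) :
  (forall t, 0 <= t -> f @ within half_line (nbhs t) --> f t) ->
  continuous (fun t => f (Num.max 0 t)).
Proof.
move=> fc t; apply: (cvg_comp _ f (@cvg_maxr0_within t)).
by apply: fc; rewrite le_max lexx.
Qed.

Lemma within_dnbhs_le t : within half_line t^' --> within half_line (nbhs t).
Proof.
move=> B tB; have tB' : \forall s \near t, half_line s -> B s := tB.
suff : \forall s \near t, s != t -> half_line s -> B s by [].
by apply: filterS tB' => s sB _.
Qed.

Lemma derivable_on_cvg V (f : R -> V) t :
  derivable_on half_line f t ->
  diff_quot f t s @[s --> within half_line t^'] --> derive_on half_line f t.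
Proof. by []. Qed.

Lemma derive_on_eq V (f : R -> V) t (l : V) : 0 <= t ->
  diff_quot f t s @[s --> within half_line t^'] --> l ->
  derive_on half_line f t = l.
Proof.
move=> t0 fl; have FF := half_line_dnbhs_proper t0.
by apply: cvg_lim fl; exact: norm_hausdorff.
Qed.

Lemma diff_quot_continuous V (f : R -> V) t (l : V) :
  diff_quot f t s @[s --> within half_line t^'] --> l ->
  f @ within half_line (nbhs t) --> f t.
Proof.
move=> fl.
have h : f t + (s - t) *: diff_quot f t s @[s --> within half_line t^'] -->
    f t + (t - t) *: l.
  apply: cvgD; first exact: cvg_cst.
  apply: cvgZ => //; apply: cvgB; last exact: cvg_cst.
  exact: cvg_trans (cvg_app id (@within_dnbhs_le t)) (cvg_within _).
rewrite subrr scale0r addr0 in h.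
move=> B Bt; have nB : B (f t) := nbhs_singleton Bt.
have : \forall s \near t, s != t -> half_line s ->
    B (f t + (s - t) *: diff_quot f t s) := h B Bt.
apply: filterS => s sB s0 /=; have [->//|st] := eqVneq s t.
have := sB st s0; rewrite /diff_quot scalerA mulfV ?subr_eq0// scale1r.
by rewrite addrC subrK.
Qed.

Lemma is_derive_half_line (f g : R -> R) t (l : R) : 0 < t ->
  (forall s, 0 <= s -> g s = f s) ->
  diff_quot (f : R -> R^o) t s @[s --> within half_line t^'] --> l ->
  is_derive t 1 g l.
Proof.
move=> t0 gf fl.
have gl : h^-1 *: (g (h *: 1 + t) - g t) @[h --> 0^'] --> (l : R^o).
  move=> B Bl; have : \forall s \near t, s != t -> half_line s ->
    B (diff_quot (f : R -> R^o) t s) := fl B Bl.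
  rewrite nbhs0P => tB.
  have pos : \forall h \near 0, 0 < t + h.
    by rewrite -(@nbhs0P R R^o (fun s => 0 < s) t); exact: lt_nbhsr.
  have : \forall h \near 0, h != 0 -> B (h^-1 *: (g (h *: 1 + t) - g t)).
    near=> h => h0.
    have th : 0 < t + h by near: h.
    have : B (diff_quot (f : R -> R^o) t (t + h)).
      have imp : t + h != t -> half_line (t + h) ->
        B (diff_quot (f : R -> R^o) t (t + h)) by near: h; exact: tB.
      apply: imp; first by rewrite -subr_eq0 addrAC subrr add0r.
      by rewrite half_lineE ltW.
    by rewrite /diff_quot -!gf ?(ltW th) ?(ltW t0)// addrAC subrr add0r
      [h *: 1]mulr1 (addrC t).
  exact.
have dg : derivable g t 1 by apply/cvg_ex; exists l.
by apply: DeriveDef => //; apply: cvg_lim gl; exact: Rhausdorff.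
Unshelve. all: by end_near. Qed.

(** The extension is m(0) plus the primitive of the derivative of [m], frozen
    for negative arguments. It has a two-sided derivative at 0, which the
    chain rule requires where the potential energy vanishes. *)
Lemma C1_extension (m : R -> R) : C1_real half_line m ->
  exists mm dm : R -> R, [/\ continuous dm,
    (forall x : R, 0 <= x -> is_derive x 1 mm (dm x)) &
    (forall x, 0 <= x -> mm x = m x)].
Proof.
move=> [dm cdm].
pose d (x : R) := derive_on half_line (m : R -> R^o) (Num.max 0 x).
have cd : continuous d.
  apply: (@within_cvg_continuous R^o) => t t0.
  by move/subspace_continuousP : cdm; apply; rewrite half_lineE.
have [F F0 dF] := exists_primitive cd.
exists (fun x => m 0 + F x), d; split => //.
  move=> x x0; have dFx := dF x x0.
  by rewrite -[d x]add0r; apply: is_deriveD.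
have cm : continuous (fun x : R => m (Num.max 0 x)).
  apply: (@within_cvg_continuous R^o) => t t0.
  by apply: (@diff_quot_continuous R^o); apply: dm; rewrite half_lineE.
pose f (x : R) := m 0 + F x - m (Num.max 0 x).
have df (x : R) : 0 < x -> is_derive x 1 f 0.
  move=> x0; have dFx := dF x (ltW x0).
  have dmx : is_derive x 1 (fun x : R => m (Num.max 0 x)) (d x).
    apply: (@is_derive_half_line m); rewrite ?x0//.
      by move=> s s0; rewrite max_r.
    by rewrite /d max_r ?(ltW x0)//; apply: dm; rewrite half_lineE ltW.
  apply: (is_derive_eq (is_deriveB (is_deriveD (is_derive_cst (m 0) x 1) dFx) dmx)).
  by rewrite add0r subrr.
have cf (x : R) : 0 <= x -> {for x, continuous f}.
  move=> x0; apply: cvgB; last exact: cm.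
  apply: cvgD; first exact: cvg_cst.
  by apply: is_derive_continuous; exact: dF.
move=> x x0.
have f0 : f 0 = 0 by rewrite /f F0 maxxx addr0 subrr.
have le1 : f 0 <= f x.
  apply: (@deriv_ge0_le _ f (fun=> 0) x x0) => [y /andP[y0 _]|y /andP[y0 _]|y _].
  - exact: cf.
  - exact: df.
  - exact: lexx.
have le2 : - f 0 <= - f x.
  apply: (@deriv_ge0_le _ (fun y => - f y) (fun=> - 0) x x0)
    => [y /andP[y0 _]|y /andP[y0 _]|y _].
  - by apply: cvgN; exact: cf.
  - by have dfy := df y y0; exact: is_deriveN.
  - by rewrite oppr0.
apply/eqP; rewrite -subr_eq0 -[X in _ - m X](max_r x0) -/(f x).
by rewrite eq_le -{2}f0 le1 andbT -oppr_ge0 -[X in X <= _]oppr0 -f0.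
Qed.

End HalfLine.

(** * Series of nonnegative terms and fractional powers in a Hilbert space *)

Section BoundedSeries.
Context {R : realType}.
Implicit Types f : nat -> R.

Lemma nneseries_leP f (B : R) : (forall k, 0 <= f k) ->
  (\sum_(k <oo) (f k)%:E <= B%:E)%E <-> (forall n, series f n <= B).
Proof.
move=> f0; split=> [fB n|fB].
  rewrite -lee_fin; apply: le_trans fB.
  rewrite /series /= -sumEFin; apply: nneseries_lim_ge => k _ _.
  by rewrite lee_fin.
apply: lime_le; first by apply: is_cvg_nneseries => k _ _; rewrite lee_fin.
by apply: nearW => n; rewrite sumEFin lee_fin; exact: fB.
Qed.

Lemma nneseries_ltyP f : (forall k, 0 <= f k) ->
  (\sum_(k <oo) (f k)%:E < +oo)%E <->
  (exists B, forall n, series f n <= B).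
Proof.
move=> f0; split=> [fy|[B]]; last first.
  by move/(nneseries_leP _ f0)/le_lt_trans; apply; rewrite ltry.
have ffin : (\sum_(k <oo) (f k)%:E)%E \is a fin_num.
  rewrite ge0_fin_numE//; apply: nneseries_ge0 => k _ _; by rewrite lee_fin.
by exists (fine (\sum_(k <oo) (f k)%:E)%E); apply/nneseries_leP; rewrite ?fineK.
Qed.

Lemma bounded_series_cvg f (B : R) : (forall k, 0 <= f k) ->
  (forall n, series f n <= B) -> cvgn (series f).
Proof.
move=> f0 fB; apply: nondecreasing_is_cvgn; first exact: nondecreasing_series.
by exists B => _ [n _ <-].
Qed.

Lemma series_le_limit f (l : R) (n : nat) : (forall k, 0 <= f k) ->
  series f @ \oo --> l -> series f n <= l.
Proof.
move=> f0 fl; rewrite -(cvg_lim (@Rhausdorff R) fl).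
apply: nondecreasing_cvgn_le; first exact: nondecreasing_series.
by apply/cvg_ex; exists l.
Qed.

Lemma limit_le_bound (u : nat -> R) (l B : R) :
  u @ \oo --> l -> (forall n, u n <= B) -> l <= B.
Proof.
move=> ul uB; rewrite -(cvg_lim (@Rhausdorff R) ul).
by apply: limr_le; [apply/cvg_ex; exists l|exact: nearW].
Qed.

End BoundedSeries.

Section HilbertSpace.
Context {R : realType} {H : completeNormedModType R} (dot : {dot H for idfun}).

Lemma dotC x y : dot x y = dot y x.
Proof. by rewrite (@hermC _ _ idfun _ dot) expr0 mul1r. Qed.

Lemma dotDl x y z : dot (x + y) z = dot x z + dot y z.
Proof. exact: linearDl. Qed.

Lemma dotDr x y z : dot x (y + z) = dot x y + dot x z.
Proof. exact: linearDr. Qed.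

Lemma dotBl x y z : dot (x - y) z = dot x z - dot y z.
Proof. exact: linearBl. Qed.

Lemma dotZl (a : R) x z : dot (a *: x) z = a * dot x z.
Proof. exact: linearZl_LR. Qed.

Lemma dot_suml (x : nat -> H) z m n :
  dot (\sum_(m <= k < n) x k) z = \sum_(m <= k < n) dot (x k) z.
Proof. exact: linear_sumlz. Qed.

Hypothesis H_hilbert : hilbert_dot dot.

Lemma dot_polar x y : dot x y = (`|x + y| ^+ 2 - `|x| ^+ 2 - `|y| ^+ 2) / 2.
Proof.
rewrite !H_hilbert dotDl (dotC x (x + y)) (dotC y (x + y)) !dotDl (dotC y x).
by field.
Qed.

(** Polarisation reduces the continuity of the inner product to that of the
    norm. *)
Lemma cvg_dot (T : Type) (F : set_system T) (FF : Filter F)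
    (f g : T -> H) (x y : H) :
  f @ F --> x -> g @ F --> y -> dot (f s) (g s) @[s --> F] --> dot x y.
Proof.
move=> fx gy; rewrite dot_polar.
under eq_fun do rewrite dot_polar.
apply: cvgM; last exact: cvg_cst.
have sq (h : T -> H) z : h @ F --> z -> `|h s| ^+ 2 @[s --> F] --> `|z| ^+ 2.
  by move=> hz; apply: (cvgM (cvg_norm hz) (cvg_norm hz)).
by apply: cvgB; [apply: cvgB|]; apply: sq => //; apply: cvgD.
Qed.

Context (e : nat -> H) (e_basis : orthonormal_basis dot e).

Lemma dot_partial_sum (c : nat -> R) (n k : nat) :
  dot (series (fun i => c i *: e i) n) (e k) = if (k < n)%N then c k else 0.
Proof.
rewrite /series /= dot_suml (eq_bigr (fun i => c i * (i == k)%:R)).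
  case: ifPn => kn; last first.
    rewrite -leqNgt in kn.
    rewrite big_nat_cond big1// => i; rewrite andbT => /andP[_ ik].
    by rewrite ltn_eqF ?mulr0// (leq_trans ik).
  rewrite (bigD1_seq k) ?iota_uniq ?mem_index_iota//= eqxx mulr1 big1 ?addr0//.
  by move=> i /negPf ->; rewrite mulr0.
by move=> i _; rewrite dotZl e_basis.1.
Qed.

Lemma dot_cvg_series (c : nat -> R) (z : H) (k : nat) :
  series (fun i => c i *: e i) @ \oo --> z -> dot z (e k) = c k.
Proof.
move=> cz.
have h : dot (series (fun i => c i *: e i) n) (e k) @[n --> \oo] --> dot z (e k).
  by apply: cvg_dot => //; exact: cvg_cst.
apply: (@cvg_unique R^o _ _ _ _ _ h); first exact: Rhausdorff.
apply: cvg_near_cst; near=> n; rewrite dot_partial_sum ifT//.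
by near: n; exact: nbhs_infty_gt.
Unshelve. all: by end_near. Qed.

Lemma parseval x y :
  series (fun k => dot x (e k) * dot y (e k)) @ \oo --> dot x y.
Proof.
have h : dot (series (fun k => dot x (e k) *: e k) n) y @[n --> \oo] --> dot x y.
  by apply: cvg_dot; [exact: e_basis.2|exact: cvg_cst].
apply: cvg_trans h; apply: near_eq_cvg; apply: nearW => n /=.
by rewrite dot_suml; apply: eq_bigr => k _; rewrite dotZl (dotC (e k)).
Qed.

Lemma parseval_sq x : series (fun k => dot x (e k) ^+ 2) @ \oo --> `|x| ^+ 2.
Proof.
rewrite H_hilbert; exact: (@parseval x x).
Qed.

(** By orthonormality the blocks of the vector series have the same squared
    norm as the blocks of the scalar series, so that one is Cauchy if the
    other is. *)
Lemma riesz_fischer (c : nat -> R) :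
  cvgn (series (fun k => c k ^+ 2)) -> cvgn (series (fun k => c k *: e k)).
Proof.
move=> /cauchy_cvgP/cauchy_seriesP cc.
apply/cauchy_cvgP/cauchy_seriesP => eps eps0.
have := cc (eps ^+ 2) (exprn_gt0 2 eps0); apply: filterS => -[m n] /=.
have -> : \sum_(m <= k < n) c k ^+ 2 = `|\sum_(m <= k < n) c k *: e k| ^+ 2.
  rewrite H_hilbert dot_suml; apply: eq_big_nat => k /andP[mk kn].
  rewrite dotZl dotC dot_suml expr2; congr (_ * _).
  rewrite (bigD1_seq k) ?iota_uniq ?mem_index_iota ?mk ?kn//=.
  rewrite dotZl e_basis.1 eqxx mulr1 big1 ?addr0//.
  by move=> i /negPf ik; rewrite dotZl e_basis.1 ik mulr0.
by rewrite ger0_norm ?sqr_ge0// ltr_pXn2r ?nnegrE ?normr_ge0 ?ltW.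
Qed.

Lemma dot_ext x y : (forall k, dot x (e k) = dot y (e k)) -> x = y.
Proof.
move=> xy; apply: (@cvg_unique _ _ _ _ _ _ (e_basis.2 x)).
  exact: norm_hausdorff.
suff -> : (fun k => dot x (e k) *: e k) = (fun k => dot y (e k) *: e k).
  exact: e_basis.2.
by apply/funext => k; rewrite xy.
Qed.

Context (lam : nat -> R) (lam_ge0 : forall k, 0 <= lam k).
Local Notation D := (power_dom dot e lam).
Local Notation Apow := (power_op dot e lam).

Lemma powR2_sq (a b : R) : (a `^ (2 * b)) ^+ 2 = a `^ (4 * b).
Proof. by rewrite -powR_mulrn ?powR_ge0// -powRrM; congr (_ `^ _); ring. Qed.

Lemma power_domP (al : R) z : D al z <->
  exists B : R, forall n, series (fun k => lam k `^ (4 * al) * dot z (e k) ^+ 2) n <= B.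
Proof.
by apply: nneseries_ltyP => k; rewrite mulr_ge0 ?powR_ge0 ?sqr_ge0.
Qed.

(** [power_op] is the limit of a series; by Riesz-Fischer that series
    converges on the domain, and its coefficients can be read off. *)
Lemma dot_power_op (al : R) z k : D al z ->
  dot (Apow al z) (e k) = lam k `^ (2 * al) * dot z (e k).
Proof.
move=> /power_domP[B zB].
apply: (@dot_cvg_series (fun k => lam k `^ (2 * al) * dot z (e k))).
apply: (@riesz_fischer (fun k => lam k `^ (2 * al) * dot z (e k))).
apply: (@bounded_series_cvg _ _ B) => [i|n]; first exact: sqr_ge0.
by under eq_fun do rewrite exprMn powR2_sq; exact: zB.
Qed.

Lemma power_op_parseval (al be : R) x y : D al x -> D be y ->
  series (fun k => lam k `^ (2 * al) * lam k `^ (2 * be) *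
                   (dot x (e k) * dot y (e k))) @ \oo -->
  dot (Apow al x) (Apow be y).
Proof.
move=> xD yD; have := @parseval (Apow al x) (Apow be y).
under eq_fun do rewrite !dot_power_op//.
by under [in X in _ -> X]eq_fun do rewrite mulrACA.
Qed.

Lemma power_op_sq (al : R) x : D al x ->
  series (fun k => lam k `^ (4 * al) * dot x (e k) ^+ 2) @ \oo -->
  `|Apow al x| ^+ 2.
Proof.
move=> xD; have := @parseval_sq (Apow al x).
under eq_fun do rewrite !dot_power_op//.
by under eq_fun do rewrite exprMn powR2_sq.
Qed.

Lemma power_dom_lin (al a : R) x y : D al x -> D al y -> D al (a *: x + y).
Proof.
move=> /power_domP[B xB] /power_domP[C yC]; apply/power_domP.
exists (2 * a ^+ 2 * B + 2 * C) => n.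
apply: (@le_trans _ _ (2 * a ^+ 2 *
    series (fun k => lam k `^ (4 * al) * dot x (e k) ^+ 2) n +
    2 * series (fun k => lam k `^ (4 * al) * dot y (e k) ^+ 2) n)).
  rewrite /series/= !mulr_sumr -big_split/=; apply: ler_sum => k _.
  rewrite dotDl dotZl.
  have := powR_ge0 (lam k) (4 * al); move: (lam k `^ _) => w w0.
  rewrite -subr_ge0.
  rewrite (_ : _ - _ = w * (a * dot x (e k) - dot y (e k)) ^+ 2); last by ring.
  by rewrite mulr_ge0// sqr_ge0.
apply: lerD; apply: ler_wpM2l => //; by rewrite mulr_ge0// sqr_ge0.
Qed.

Lemma power_op_lin (al a : R) x y : D al x -> D al y ->
  Apow al (a *: x + y) = a *: Apow al x + Apow al y.
Proof.
move=> xD yD; apply: dot_ext => k; rewrite dotDl dotZl !dot_power_op//.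
  by rewrite dotDl dotZl; ring.
exact: power_dom_lin.
Qed.

Lemma power_domD (al : R) x y : D al x -> D al y -> D al (x + y).
Proof. by move=> xD yD; rewrite -[x]scale1r; exact: power_dom_lin. Qed.

Lemma power_opD (al : R) x y : D al x -> D al y ->
  Apow al (x + y) = Apow al x + Apow al y.
Proof. by move=> xD yD; rewrite -{1}[x]scale1r power_op_lin// scale1r. Qed.

Lemma power_domB (al : R) x y : D al x -> D al y -> D al (x - y).
Proof.
by move=> xD yD; rewrite addrC -scaleN1r; exact: power_dom_lin.
Qed.

Lemma power_opB (al : R) x y : D al x -> D al y ->
  Apow al (x - y) = Apow al x - Apow al y.
Proof.
by move=> xD yD; rewrite addrC -scaleN1r power_op_lin// scaleN1r addrC.
Qed.

Lemma power_domZ (al a : R) x : D al x -> D al (a *: x).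
Proof.
move=> xD; rewrite -[a *: x]addr0 -[X in _ + X](subrr x).
by apply: power_dom_lin => //; exact: power_domB.
Qed.

Lemma power_opZ (al a : R) x : D al x -> Apow al (a *: x) = a *: Apow al x.
Proof.
move=> xD; apply: dot_ext => k.
by rewrite dotZl !dot_power_op ?dotZl 1?mulrCA//; exact: power_domZ.
Qed.

Lemma norm_le_graph_norm (al : R) z : `|z| <= graph_norm dot e lam al z.
Proof.
rewrite -[X in X <= _](ger0_norm (normr_ge0 z)) -sqrtr_sqr.
by rewrite ler_wsqrtr// lerDl sqr_ge0.
Qed.

Lemma power_op_le_graph_norm (al : R) z :
  `|Apow al z| <= graph_norm dot e lam al z.
Proof.
rewrite -[X in X <= _](ger0_norm (normr_ge0 _)) -sqrtr_sqr.
by rewrite ler_wsqrtr// lerDr sqr_ge0.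
Qed.

End HilbertSpace.

(** * Sequences of oscillators coupled through their potential energy *)

Lemma continuous_maxr0 (R : realType) (T : topologicalType) (f : R -> T) :
  (forall x : R, 0 <= x -> {for x, continuous f}) ->
  continuous (fun x : R => f (Num.max 0 x)).
Proof.
move=> cf x; apply: (continuous_comp (f := fun x : R => Num.max 0 x)).
  by apply: continuous_max; [exact: cvg_cst|exact: cvg_id].
by apply: cf; rewrite le_max lexx.
Qed.

Lemma seriesMl (R : realType) (f : nat -> R) (c : R) n :
  series (fun k => c * f k) n = c * series f n.
Proof. by rewrite /series/= mulr_sumr. Qed.

Lemma is_derive_series (R : realType) (f : nat -> R -> R) (df : nat -> R)
    (t : R) n :
  (forall k, is_derive t 1 (f k) (df k)) ->
  is_derive t 1 (fun s => series (f ^~ s) n) (series df n).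
Proof.
move=> fE; elim: n => [|n IHn].
  rewrite /series/= big_geq//; under eq_fun do rewrite big_geq//.
  exact: is_derive_cst.
rewrite seriesSr; under eq_fun do rewrite seriesSr.
exact: is_deriveD.
Qed.

Lemma continuous_sqr (R : realType) (f : R -> R) (t : R) :
  {for t, continuous f} -> {for t, continuous (fun s => f s ^+ 2)}.
Proof. by move=> cf; apply: (continuousM cf cf). Qed.

Lemma continuous_series (R : realType) (f : nat -> R -> R) (t : R) n :
  (forall k, {for t, continuous (f k)}) ->
  {for t, continuous (fun s => series (f ^~ s) n)}.
Proof.
move=> cf; elim: n => [|n IHn].
  have -> : (fun s => series (f ^~ s) 0) = cst 0.
    by apply/funext => s; rewrite /series/= big_geq.
  exact: cvg_cst.
have -> : (fun s => series (f ^~ s) n.+1) = (fun s => series (f ^~ s) n + f n s).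
  by apply/funext => s; rewrite seriesSr.
by apply: cvgD; [exact: IHn|exact: cf].
Qed.

(** The series of [g + f] and [g - f] have nonnegative terms, so that their
    partial sums lie below their limits. *)
Lemma series_tail_le (R : realType) (f g : nat -> R) (F G : R) n :
  (forall k, `|f k| <= g k) ->
  series f @ \oo --> F -> series g @ \oo --> G ->
  `|F - series f n| <= G - series g n.
Proof.
move=> fg fF gG.
have seriesD (h : nat -> R) (b : R) : h = (fun k => g k + b * f k) ->
    series h = (fun n => series g n + b * series f n).
  by move=> ->; apply/funext => i; rewrite /series/= big_split/= mulr_sumr.
have tail (b : R) : (forall k, 0 <= g k + b * f k) ->
    series g n + b * series f n <= G + b * F.
  move=> pos; have := @series_le_limit R _ (G + b * F) n pos.
  rewrite (seriesD _ b erefl); apply; apply: cvgD => //.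
  by apply: cvgM => //; exact: cvg_cst.
have := tail 1; have := tail (- 1).
rewrite ler_norml !mulN1r !mul1r => h1 h2.
have {}h1 : series g n - series f n <= G - F.
  by apply: h1 => k; rewrite mulN1r subr_ge0 (le_trans (ler_norm _)).
have {}h2 : series g n + series f n <= G + F.
  apply: h2 => k; rewrite mul1r -lerBlDr sub0r; apply: le_trans (fg k).
  by rewrite -normrN ler_norm.
by apply/andP; split; lra.
Qed.

Definition modal_energy (R : realType) (lam : nat -> R) (mm : R -> R)
    (U V : nat -> R -> R) (p : R -> R) (k : nat) (t : R) : R :=
  V k t ^+ 2 + mm (p t) * lam k ^+ 2 * U k t ^+ 2.

(** The abstract form of the problem. [U k] and [V k] are the position and the
    speed of the k-th mode and [mm] is the squared propagation speed as a
    function of the potential [p] = |A^(1/2) u|^2. The other sums are its rate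
    of change [q], the kinetic energy [N] and the frequency-weighted energy
    [S] = |A^(1/4) u'|^2 + mm(p) |A^(3/4) u|^2. *)
Record modal_flow (R : realType) (lam : nat -> R) (mm : R -> R)
    (U V : nat -> R -> R) (p q N S : R -> R) : Prop := ModalFlow {
  mode_deriv : forall k (t : R), 0 < t -> is_derive t 1 (U k) (V k t);
  speed_deriv : forall k (t : R), 0 < t ->
    is_derive t 1 (V k) (- (mm (p t) * lam k ^+ 2 * U k t));
  potential_deriv : forall t : R, 0 < t -> is_derive t 1 p (q t);
  mode_cont : forall k, continuous (U k);
  speed_cont : forall k, continuous (V k);
  potential_cont : continuous p;
  weighted_cont : continuous S;
  potential_sum : forall t,
    series (fun k => lam k ^+ 2 * U k t ^+ 2) @ \oo --> p t;
  potential_rate_sum : forall t,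
    series (fun k => 2 * lam k ^+ 2 * (U k t * V k t)) @ \oo --> q t;
  kinetic_sum : forall t, series (fun k => V k t ^+ 2) @ \oo --> N t;
  weighted_sum : forall t,
    series (fun k => lam k * modal_energy lam mm U V p k t) @ \oo --> S t
}.

Section ModalFlow.
Context {R : realType} (lam : nat -> R) (mm dm : R -> R) (nu0 : R).
Context (U V : nat -> R -> R) (p q N S : R -> R).
Hypotheses (lam_ge0 : forall k, 0 <= lam k) (nu0_gt0 : 0 < nu0).
Hypothesis mm_deriv : forall x : R, 0 <= x -> is_derive x 1 mm (dm x).
Hypothesis dm_cont : continuous dm.
Hypothesis mm_ge : forall x, 0 <= x -> nu0 <= mm x.
Hypothesis flow : modal_flow lam mm U V p q N S.

Local Notation a := (modal_energy lam mm U V p).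
Let kappa := 1 + nu0^-1.

Let kappa_gt0 : 0 < kappa.
Proof. by rewrite addr_gt0 ?ltr01 ?invr_gt0. Qed.

Lemma potential_ge0 t : 0 <= p t.
Proof.
have := @series_le_limit R _ _ 0 _ (potential_sum flow (t := t)).
by rewrite /series/= big_geq//; apply=> k; rewrite mulr_ge0 ?sqr_ge0.
Qed.

Let mm_gt0 t : 0 < mm (p t).
Proof. exact: lt_le_trans nu0_gt0 (mm_ge (potential_ge0 t)). Qed.

Lemma modal_energy_ge0 k t : 0 <= a k t.
Proof.
apply: addr_ge0; first exact: sqr_ge0.
by rewrite -mulrA mulr_ge0 ?(ltW (mm_gt0 _))// -exprMn sqr_ge0.
Qed.

Lemma free_energy_le k t :
  V k t ^+ 2 + lam k ^+ 2 * U k t ^+ 2 <= kappa * a k t.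
Proof.
have w0 : 0 <= lam k ^+ 2 * U k t ^+ 2 by rewrite mulr_ge0 ?sqr_ge0.
have v0 := sqr_ge0 (V k t).
have h : lam k ^+ 2 * U k t ^+ 2 <= nu0^-1 * (mm (p t) * (lam k ^+ 2 * U k t ^+ 2)).
  rewrite (mulrA nu0^-1) -[leLHS]mul1r ler_wpM2r// ler_pdivlMl ?mulr1//.
  exact: mm_ge (potential_ge0 t).
rewrite /modal_energy -(mulrA (mm _)) mulrDl mul1r.
have : 0 <= nu0^-1 * V k t ^+ 2 by rewrite mulr_ge0// invr_ge0 ltW.
have : 0 <= mm (p t) * (lam k ^+ 2 * U k t ^+ 2) by rewrite mulr_ge0// (ltW (mm_gt0 _)).
by move: h; lra.
Qed.

(** The arithmetic-geometric inequality, with one factor lam_k left over: this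
    is why the weight of S is lam_k to the power one. *)
Lemma rate_term_le k t :
  `|2 * lam k ^+ 2 * (U k t * V k t)| <= kappa * (lam k * a k t).
Proof.
rewrite (_ : 2 * _ * _ = lam k * (2 * ((lam k * U k t) * V k t))); last by ring.
rewrite normrM (ger0_norm (lam_ge0 k)) [leRHS]mulrCA ler_wpM2l//.
apply: le_trans (free_energy_le k t); rewrite -exprMn.
move: (lam k * U k t) (V k t) => x y; rewrite ler_norml; apply/andP; split.
  by have := sqr_ge0 (x + y); rewrite sqrrD; lra.
by have := sqr_ge0 (x - y); rewrite sqrrB; lra.
Qed.

Let kappa_weighted_sum t :
  series (fun k => kappa * (lam k * a k t)) @ \oo --> kappa * S t.
Proof.
have -> : series (fun k => kappa * (lam k * a k t)) =
    (fun n => kappa * series (fun k => lam k * a k t) n).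
  by apply/funext => n; rewrite seriesMl.
by apply: cvgM; [exact: cvg_cst|exact: (weighted_sum flow)].
Qed.

Lemma potential_rate_tail t n :
  `|q t - series (fun k => 2 * lam k ^+ 2 * (U k t * V k t)) n|
  <= kappa * (S t - series (fun k => lam k * a k t) n).
Proof.
have := series_tail_le n (rate_term_le ^~ t) (potential_rate_sum flow (t := t))
  (kappa_weighted_sum (t := t)).
by rewrite seriesMl mulrBr.
Qed.

Lemma potential_rate_le t : `|q t| <= kappa * S t.
Proof. by have := potential_rate_tail t 0; rewrite /series/= !big_geq// !subr0. Qed.

Lemma weighted_ge0 t : 0 <= S t.
Proof.
by have := le_trans (normr_ge0 _) (potential_rate_le t); rewrite pmulr_rge0.
Qed.

(** Only the variation of the propagation speed changes the energy of a single
    mode; the other terms of the derivative cancel. *)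
Lemma modal_energy_deriv k (t : R) : 0 < t ->
  is_derive t 1 (a k) (dm (p t) * q t * lam k ^+ 2 * U k t ^+ 2).
Proof.
move=> t0.
have dV := speed_deriv flow k t0; have dU := mode_deriv flow k t0.
have dp := potential_deriv flow t0.
have dmm : is_derive (p t) 1 mm (dm (p t)) := mm_deriv (potential_ge0 t).
have dc : is_derive t 1 (fun t => mm (p t)) (dm (p t) * q t).
  exact: (is_derive1_comp (f := mm) (g := p)).
rewrite /modal_energy.
apply: is_derive_eq.
by rewrite /GRing.scale /=; ring.
Qed.

Lemma modal_energy_cont k : continuous (a k).
Proof.
move=> t.
have cmm : {for p t, continuous mm}.
  exact: is_derive_continuous (mm_deriv (potential_ge0 t)).
have cc : {for t, continuous (fun t => mm (p t))}.
  by apply: (continuous_comp (f := p)) cmm; exact: (potential_cont flow).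
have cU := mode_cont flow (k := k) (x := t).
have cV := speed_cont flow (k := k) (x := t).
rewrite /modal_energy /continuous_at; apply: cvgD.
  exact: continuous_sqr.
apply: cvgM; first by apply: cvgM => //; exact: cvg_cst.
exact: continuous_sqr.
Qed.

(** The exponent does not depend on [k]: all modes grow at most by a common
    factor. *)
Lemma modal_energy_growth (b db : R -> R) (T : R) k :
  0 <= T ->
  (forall t : R, 0 <= t <= T -> {for t, continuous b}) ->
  (forall t : R, 0 < t < T -> is_derive t 1 b (db t)) ->
  (forall t : R, 0 < t < T -> `|dm (p t)| * (kappa / nu0) * S t <= db t) ->
  a k T <= a k 0 * expR (b T - b 0).
Proof.
move=> T0 cb dbE dbS; apply: gronwall T0 _ cb _ dbE _.
- by move=> t _; exact: modal_energy_cont.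
- by move=> t /andP[t0 _]; exact: modal_energy_deriv.
move=> t tT /=; apply: le_trans (ler_wpM2r (modal_energy_ge0 k t) (dbS t tT)).
have w0 : 0 <= lam k ^+ 2 * U k t ^+ 2 by rewrite -exprMn sqr_ge0.
have h : lam k ^+ 2 * U k t ^+ 2 <= nu0^-1 * a k t.
  rewrite ler_pdivlMl// /modal_energy -(mulrA (mm _)).
  apply: (@le_trans _ _ (mm (p t) * (lam k ^+ 2 * U k t ^+ 2))).
    by rewrite ler_wpM2r// mm_ge// potential_ge0.
  by rewrite lerDr sqr_ge0.
have -> : `|dm (p t)| * (kappa / nu0) * S t * a k t =
    (`|dm (p t)| * (kappa * S t)) * (nu0^-1 * a k t) by ring.
rewrite -(mulrA _ (lam k ^+ 2)); apply: le_trans (ler_wpM2r w0 (ler_norm _)) _.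
apply: ler_pM => //; rewrite normrM ler_wpM2l//.
exact: potential_rate_le.
Qed.

Lemma potential_bounded (T : R) (f : R -> R) : continuous f ->
  exists2 K : R, 0 < K & forall t : R, 0 <= t <= T -> `|f (p t)| <= K.
Proof.
move=> cf; apply: (@continuous_bounded_itv R (fun t => f (p t))) => t.
apply: (continuous_comp (f := p)); last exact: cf.
exact: (potential_cont flow).
Qed.

Lemma mm_maxr0_cont : continuous (fun x : R => mm (Num.max 0 x)).
Proof.
by apply: continuous_maxr0 => x x0; exact: is_derive_continuous (mm_deriv x0).
Qed.

(** On [0, T] the functions dm(p) and [S] are bounded by continuity, so that
    the modal energies are dominated by a multiple of their initial values.
    This local constant gives the energy inequality, from which the global one
    is derived. *)
Lemma local_tail_bound (T : R) : 0 <= T ->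
  exists2 X : R, 0 < X & forall t n, 0 <= t <= T ->
    S t - series (fun k => lam k * a k t) n
    <= X * (S 0 - series (fun k => lam k * a k 0) n).
Proof.
move=> T0; have [K K0 dmK] := potential_bounded T dm_cont.
have [Z Z0 SZ] := continuous_bounded_itv T (weighted_cont flow).
have c0 : 0 <= K * (kappa / nu0) * Z.
  by rewrite !mulr_ge0 ?invr_ge0// ltW.
set c := K * _ * Z in c0.
exists (expR (c * T)); first exact: expR_gt0.
move=> t n /andP[t0 tT].
have growth k : a k t <= expR (c * T) * a k 0.
  apply: (@le_trans _ _ (a k 0 * expR (c * t - c * 0))).
    apply: (@modal_energy_growth (fun s => c * s) (fun=> c) t k t0).
    - by move=> s _; apply: cvgM; [exact: cvg_cst|exact: cvg_id].
    - move=> s _; have := is_deriveZ c (is_derive_id s (1 : R)).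
      by rewrite /GRing.scale/= mulr1.
    - move=> s /andP[s0 st]; have sT : 0 <= s <= T.
        by rewrite (ltW s0)/= (le_trans (ltW st)).
      rewrite /c; apply: ler_pM => //.
      + by rewrite !mulr_ge0 ?invr_ge0// ltW.
      + exact: weighted_ge0.
      + by apply: ler_wpM2r (dmK s sT); rewrite mulr_ge0 ?invr_ge0// ltW.
      + exact: le_trans (ler_norm _) (SZ s sT).
  rewrite mulr0 subr0 mulrC ler_wpM2r ?modal_energy_ge0// ler_expR.
  by rewrite ler_wpM2l.
have XS : series (fun k => expR (c * T) * (lam k * a k 0)) @ \oo --> expR (c * T) * S 0.
  have -> : series (fun k => expR (c * T) * (lam k * a k 0)) =
      (fun n => expR (c * T) * series (fun k => lam k * a k 0) n).
    by apply/funext => i; rewrite seriesMl.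
  by apply: cvgM; [exact: cvg_cst|exact: (weighted_sum flow)].
have la k : `|lam k * a k t| <= expR (c * T) * (lam k * a k 0).
  rewrite ger0_norm ?mulr_ge0 ?modal_energy_ge0// [leRHS]mulrCA.
  by rewrite ler_wpM2l.
have := series_tail_le n la (weighted_sum flow (t := t)) XS.
by rewrite seriesMl -mulrBr; apply: le_trans; exact: ler_norm.
Qed.

(** [M] being a primitive of [mm], the derivative of the energy truncated at
    the n-th mode is mm(p) times the tail of the series of [q]. By
    [local_tail_bound] this tail is small uniformly on [0, T]. *)
Lemma energy_nonincreasing (M : R -> R) (T : R) : 0 <= T ->
  (forall x : R, 0 <= x -> is_derive x 1 M (mm x)) ->
  N T + M (p T) <= N 0 + M (p 0).
Proof.
move=> T0 dM.
have [C C0 mmC] := potential_bounded T mm_maxr0_cont.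
have [X X0 tailX] := local_tail_bound T0.
(* r n bounds the rate at which the truncated energy can increase. *)
pose r n := C * (kappa * (X * (S 0 - series (fun k => lam k * a k 0) n))).
have rn : r n @[n --> \oo] --> 0.
  rewrite -(mulr0 C) -(mulr0 kappa) -(mulr0 X) -(subrr (S 0)).
  do 3 (apply: cvgM; first exact: cvg_cst).
  by apply: cvgB; [exact: cvg_cst|exact: (weighted_sum flow)].
pose E n t := series (fun k => V k t ^+ 2) n + M (p t).
have step n : E n T <= E n 0 + r n * T.
  pose f t := r n * t - E n t.
  pose w (t : R) := series (fun k => 2 * lam k ^+ 2 * (U k t * V k t)) n.
  have : f 0 <= f T.
    have cf (t : R) : 0 <= t <= T -> {for t, continuous f}.
      move=> _; apply: cvgB.
        by apply: cvgM; [exact: cvg_cst|exact: cvg_id].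
      apply: cvgD.
        apply: (@continuous_series R (fun k s => V k s ^+ 2)) => k.
        by apply: continuous_sqr; exact: (speed_cont flow).
      apply: (continuous_comp (f := p)); first exact: (potential_cont flow).
      exact: is_derive_continuous (dM _ (potential_ge0 t)).
    have df (t : R) : 0 < t < T ->
        is_derive t 1 f (r n - mm (p t) * (q t - w t)).
      move=> /andP[t0 _].
      have dp := potential_deriv flow t0.
      have dMp : is_derive t 1 (fun t => M (p t)) (mm (p t) * q t).
        have := dM _ (potential_ge0 t) => dMx.
        exact: (is_derive1_comp (f := M) (g := p)).
      have dk : is_derive t 1 (fun t => series (fun k => V k t ^+ 2) n)
                  (- (mm (p t) * w t)).
        have -> : - (mm (p t) * w t) = series (fun k =>
            V k t *: - (mm (p t) * lam k ^+ 2 * U k t) +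
            V k t *: - (mm (p t) * lam k ^+ 2 * U k t)) n.
          rewrite -mulNr /w -seriesMl; apply: eq_bigr => k _.
          by rewrite /GRing.scale/=; ring.
        apply: (@is_derive_series R (fun k s => V k s ^+ 2)) => k.
        have dV := speed_deriv flow k t0.
        exact: (is_deriveM dV dV).
      have dr : is_derive t 1 (fun t : R => r n * t) (r n).
        have := is_deriveZ (r n) (is_derive_id t (1 : R)).
        by rewrite /GRing.scale/= mulr1.
      apply: (is_derive_eq (is_deriveB dr (is_deriveD dk dMp))).
      by ring.
    apply: (deriv_ge0_le T0 cf df) => t /andP[t0 tT].
    have t0T : 0 <= t <= T by rewrite !ltW.
    rewrite subr_ge0; apply: le_trans (ler_norm _) _; rewrite normrM.
    apply: ler_pM; rewrite ?normr_ge0//.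
      by have := mmC t t0T; rewrite max_r// potential_ge0.
    apply: le_trans (potential_rate_tail t n) _.
    by rewrite ler_wpM2l ?(ltW kappa_gt0)//; exact: tailX.
  by rewrite /f mulr0 sub0r; lra.
have lim : series (fun k => V k T ^+ 2) n + M (p T) - r n * T @[n --> \oo] -->
    N T + M (p T) - 0 * T.
  apply: cvgB; last by apply: cvgM => //; exact: cvg_cst.
  by apply: cvgD; [exact: (kinetic_sum flow)|exact: cvg_cst].
have := @limit_le_bound R _ _ (N 0 + M (p 0)) lim.
rewrite mul0r subr0; apply => n; rewrite lerBlDr (le_trans (step n))// lerD2r.
rewrite lerD2r; apply: series_le_limit; last exact: (kinetic_sum flow).
by move=> k; exact: sqr_ge0.
Qed.

Lemma primitive_ge (M : R -> R) (x : R) : M 0 = 0 ->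
  (forall x : R, 0 <= x -> is_derive x 1 M (mm x)) ->
  0 <= x -> nu0 * x <= M x.
Proof.
move=> M0 dM x0; pose f y := M y - nu0 * y.
have df (y : R) : 0 <= y -> is_derive y 1 f (mm y - nu0).
  move=> y0; apply: is_deriveB; first exact: dM.
  apply: (is_derive_eq (is_deriveZ nu0 (is_derive_id y (1 : R)))).
  exact: mulr1.
have : f 0 <= f x.
  apply: (deriv_ge0_le x0 (df := fun y => mm y - nu0)).
  - by move=> y /andP[y0 _]; exact: is_derive_continuous (df y y0).
  - by move=> y /andP[/ltW y0 _]; exact: df.
  - by move=> y /andP[/ltW y0 _]; rewrite subr_ge0 mm_ge.
by rewrite /f M0 mulr0 subr0 subr_ge0.
Qed.

(** The energy inequality confines [p] to a bounded interval, where the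
    continuous functions [mm] and [dm] are bounded. *)
Theorem modal_energy_estimate : exists (E0 C : R) (L : R -> R),
  [/\ 0 < E0, 0 < C, L 0 = 0,
      (forall t : R, 0 <= t -> is_derive t 1 L (C * S t)) &
      (forall t : R, 0 <= t ->
         (forall k, a k t <= a k 0 * expR (L t)) /\
         (forall n, series (fun k => a k t) n <= E0))].
Proof.
have [M M0 dM'] := exists_primitive mm_maxr0_cont.
have dM (x : R) : 0 <= x -> is_derive x 1 M (mm x).
  by move=> x0; have := dM' x x0; rewrite max_r.
have [I I0 dI] := exists_primitive (weighted_cont flow).
have N0 t : 0 <= N t.
  have := @series_le_limit R _ _ 0 _ (kinetic_sum flow (t := t)).
  by rewrite /series/= big_geq//; apply=> k; exact: sqr_ge0.
have M_ge t := primitive_ge M0 dM (potential_ge0 t).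
set E00 := N 0 + M (p 0).
have energy t : 0 <= t -> N t + M (p t) <= E00.
  by move=> t0; exact: energy_nonincreasing.
pose P := E00 / nu0.
have p_le t : 0 <= t -> 0 <= p t <= P.
  move=> t0; rewrite potential_ge0 ler_pdivlMr// mulrC.
  by apply: le_trans (M_ge t) _; apply: le_trans (energy t t0); rewrite lerDr.
have [L L0 dmL] := continuous_bounded_itv P dm_cont.
have [Cm Cm0 mmC] := continuous_bounded_itv P mm_maxr0_cont.
have P0 : 0 <= P by have /andP[] := p_le 0 (lexx 0); exact: le_trans.
have E00_ge0 : 0 <= E00.
  by rewrite addr_ge0// (le_trans _ (M_ge 0))// mulr_ge0 ?potential_ge0// ltW.
pose C := L * (kappa / nu0).
have C0 : 0 < C by rewrite !mulr_gt0 ?invr_gt0.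
exists (E00 + Cm * P + 1), C, (fun t => C * I t).
have dL (t : R) : 0 <= t -> is_derive t 1 (fun t => C * I t) (C * S t).
  by move=> t0; have := dI t t0 => dIt; exact: is_deriveZ.
split => //; [|by rewrite I0 mulr0|].
  by rewrite ltr_wpDl// addr_ge0// mulr_ge0// ltW.
move=> t t0; split=> [k|n].
  have := @modal_energy_growth (fun t => C * I t) (fun t => C * S t) t k t0.
  rewrite I0 mulr0 subr0; apply.
  - by move=> s /andP[s0 _]; exact: is_derive_continuous (dL s s0).
  - by move=> s /andP[/ltW s0 _]; exact: dL.
  - move=> s /andP[/ltW s0 _]; apply: ler_wpM2r; first exact: weighted_ge0.
    apply: ler_wpM2r; last exact: dmL (p_le s s0).
    by rewrite mulr_ge0 ?invr_ge0// ltW.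
have -> : series (fun k => a k t) n = series (fun k => V k t ^+ 2) n +
    mm (p t) * series (fun k => lam k ^+ 2 * U k t ^+ 2) n.
  rewrite -seriesMl /series/= -big_split/=.
  by apply: eq_bigr => k _; rewrite /modal_energy mulrA.
have /andP[_ ptP] := p_le t t0.
apply: (@le_trans _ _ (E00 + Cm * P)); last by rewrite lerDl.
apply: lerD.
  apply: (@le_trans _ _ (N t)).
    by apply: series_le_limit (kinetic_sum flow (t := t)) => k; exact: sqr_ge0.
  apply: le_trans (energy t t0); rewrite lerDl.
  by apply: le_trans (M_ge t); rewrite mulr_ge0 ?potential_ge0// ltW.
apply: ler_pM; first exact/ltW/mm_gt0.
- by rewrite /series/=; apply: sumr_ge0 => k _; rewrite -exprMn sqr_ge0.
- have := mmC _ (p_le t t0); rewrite max_r ?potential_ge0//.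
  by apply: le_trans; exact: ler_norm.
- apply: le_trans ptP; apply: series_le_limit (potential_sum flow (t := t)) => k.
  by rewrite -exprMn sqr_ge0.
Qed.

End ModalFlow.

(** * From a solution in the Hilbert space to its modes *)

Section Kirchhoff.
Context {R : realType} {H : completeNormedModType R} (dot : {dot H for idfun}).
Context (e : nat -> H) (lam : nat -> R).
Hypotheses (H_hilbert : hilbert_dot dot) (e_basis : orthonormal_basis dot e).
Hypothesis lam_ge0 : forall k, 0 <= lam k.

Local Notation D := (power_dom dot e lam).
Local Notation Apow := (power_op dot e lam).

Lemma powR_le_1D (x al be : R) : 0 <= x -> 0 <= al -> al <= be ->
  x `^ al <= 1 + x `^ be.
Proof.
move=> x0 al0 albe; have [x1|/ltW x1] := leP x 1.
  apply: (@le_trans _ _ 1); last by rewrite lerDl powR_ge0.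
  have <- : 1 `^ al = 1 :> R by rewrite powR1.
  by apply: ge0_ler_powR; rewrite ?nnegrE.
by apply: (@le_trans _ _ (x `^ be)); [exact: ler_powR|rewrite lerDr].
Qed.

Lemma power_dom_le (al be : R) z : 0 <= al -> al <= be -> D be z -> D al z.
Proof.
move=> al0 albe /power_domP[B zB]; apply/power_domP; exists (`|z| ^+ 2 + B) => n.
have zz := parseval_sq H_hilbert e_basis (x := z).
apply: le_trans (lerD (series_le_limit n _ zz) (zB n)).
  rewrite /series/= -big_split/=; apply: ler_sum => k _.
  rewrite -[X in _ <= X + _]mul1r -mulrDl ler_wpM2r ?sqr_ge0//.
  by rewrite powR_le_1D// ?mulr_ge0// ler_pM2l.
by move=> k; exact: sqr_ge0.
Qed.

Lemma graph_norm_cvg (T : Type) (F : set_system T) (FF : Filter F)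
    (al : R) (g : T -> H) (l : H) :
  D al l -> (\forall s \near F, D al (g s)) ->
  graph_norm dot e lam al (g s - l) @[s --> F] --> (0 : R) ->
  g @ F --> l /\ Apow al (g s) @[s --> F] --> Apow al l.
Proof.
move=> lD gD gl; have {}gl := [elaborate cvgr0_norm_le _ gl].
split; apply/cvgrPdist_le => eps eps0.
  apply: filterS (gl eps eps0) => s; apply: le_trans; rewrite distrC.
  by apply: le_trans (norm_le_graph_norm dot e lam al _) _; exact: ler_norm.
near=> s.
have gs : D al (g s) by near: s.
have : `|graph_norm dot e lam al (g s - l)| <= eps by near: s; exact: gl.
apply: le_trans; rewrite distrC -(power_opB H_hilbert e_basis)//.
by apply: le_trans (power_op_le_graph_norm dot e lam al _) _; exact: ler_norm.
Unshelve. all: by end_near. Qed.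

Lemma series_powR (al : R) n (f : nat -> R) : 4 * al = n%:R ->
  series (fun k => lam k `^ (4 * al) * f k) = series (fun k => lam k ^+ n * f k).
Proof.
move=> aln; congr series; apply/funext => k.
by rewrite aln powR_mulrn.
Qed.

(** The exponents 1/2 and 3/2 of lam_k add up to 2: this pairing of D(A^(1/4))
    with D(A^(3/4)) represents the derivative of |A^(1/2) u|^2, although u'
    need not be in D(A^(1/2)). *)
Lemma power_quarter_threequarter x y : D (1 / 4) x -> D (3 / 4) y ->
  series (fun k => lam k ^+ 2 * (dot x (e k) * dot y (e k))) @ \oo -->
  dot (Apow (1 / 4) x) (Apow (3 / 4) y).
Proof.
move=> xD yD.
suff -> : (fun k => lam k ^+ 2 * (dot x (e k) * dot y (e k))) =
    (fun k => lam k `^ (2 * (1 / 4)) * lam k `^ (2 * (3 / 4)) *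
              (dot x (e k) * dot y (e k))) by exact: power_op_parseval.
apply/funext => k; congr (_ * _); apply/esym; rewrite -powRD; last first.
  by apply/implyP => /eqP h; exfalso; move: h; apply/eqP/lt0r_neq0; lra.
rewrite (_ : _ + _ = 2%:R); last by field.
by rewrite powR_mulrn.
Qed.

Lemma power_half_sqB x y : D (3 / 4) x -> D (3 / 4) y ->
  `|Apow (1 / 2) x| ^+ 2 - `|Apow (1 / 2) y| ^+ 2 =
  dot (Apow (1 / 4) (x - y)) (Apow (3 / 4) (x + y)).
Proof.
move=> xD yD.
have D12 z : D (3 / 4) z -> D (1 / 2) z by apply: power_dom_le; lra.
have D14 z : D (3 / 4) z -> D (1 / 4) z by apply: power_dom_le; lra.
have xyD : D (3 / 4) (x + y) by exact: power_domD.
have xyB : D (1 / 4) (x - y) by apply: power_domB; exact: D14.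
have := power_quarter_threequarter xyB xyD.
have := cvgB (power_op_sq H_hilbert e_basis (D12 x xD))
             (power_op_sq H_hilbert e_basis (D12 y yD)).
do 2 (rewrite (@series_powR _ 2); last by field).
move=> h1 h2.
have h3 : series (fun k => lam k ^+ 2 *
    (dot (x - y) (e k) * dot (x + y) (e k))) @ \oo -->
    `|Apow (1 / 2) x| ^+ 2 - `|Apow (1 / 2) y| ^+ 2.
  suff -> : series (fun k => lam k ^+ 2 *
      (dot (x - y) (e k) * dot (x + y) (e k))) =
    series (fun k => lam k ^+ 2 * dot x (e k) ^+ 2) \-
    series (fun k => lam k ^+ 2 * dot y (e k) ^+ 2) by exact: h1.
  apply/funext => n; rewrite /series /= -sumrB; apply: eq_bigr => k _.
  by rewrite dotBl dotDl; ring.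
exact: (@cvg_unique R^o (@Rhausdorff R) _ _ _ _ h3 h2).
Qed.

Context (m : R -> R) (u : R -> H).
Hypothesis u_C0 : C0_dom dot e lam half_line (3 / 4) u.
Hypothesis u_C1 : C1_dom dot e lam half_line (1 / 4) u.
Local Notation u' := (derive_on half_line u).

Let uD t : 0 <= t -> D (3 / 4) (u t).
Proof. by rewrite -half_lineE => /u_C0[]. Qed.

Let u'D t : 0 <= t -> D (1 / 4) (u' t).
Proof. by rewrite -half_lineE; case: u_C1 => _ + _ => /[apply] -[]. Qed.

Let uD14 t : 0 <= t -> D (1 / 4) (u t).
Proof. by move=> /uD; apply: power_dom_le; lra. Qed.

Let near_half_line (G : set_system R) (P : R -> Prop) : Filter G ->
  (forall s, 0 <= s -> P s) -> \forall s \near within half_line G, P s.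
Proof.
move=> FG sP; suff : G (fun s => half_line s -> P s) by [].
by apply: filterE => s; rewrite half_lineE; exact: sP.
Qed.

Let C0_cvg (al : R) (f : R -> H) (t : R) : C0_dom dot e lam half_line al f -> 0 <= t ->
  f @ within half_line (nbhs t) --> f t /\
  Apow al (f s) @[s --> within half_line (nbhs t)] --> Apow al (f t).
Proof.
move=> fC t0; have t0' : half_line t by rewrite half_lineE.
have [ftD ft] := fC t t0'.
apply: graph_norm_cvg => //; apply: near_half_line => s.
by rewrite -half_lineE => /fC[].
Qed.

Lemma diff_quot_cvg (t : R) : 0 <= t ->
  diff_quot u t s @[s --> within half_line t^'] --> u' t /\
  Apow (1 / 4) (diff_quot u t s) @[s --> within half_line t^'] -->
  Apow (1 / 4) (u' t).
Proof.
move=> t0; have [_ _ dq] := u_C1.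
apply: graph_norm_cvg; [exact: u'D| |by apply: dq; rewrite half_lineE].
apply: near_half_line => s s0.
by apply: power_domZ => //; apply: power_domB => //; exact: uD14.
Qed.

Lemma coef_diff_quot (t : R) k : 0 <= t ->
  diff_quot (coef dot e u k) t s @[s --> within half_line t^'] -->
  (dot (u' t) (e k) : R^o).
Proof.
move=> t0; have [h _] := diff_quot_cvg t0.
have -> : diff_quot (coef dot e u k) t = fun s => dot (diff_quot u t s) (e k).
  by apply/funext => s; rewrite /diff_quot /coef dotZl dotBl.
by apply: cvg_dot => //; exact: cvg_cst.
Qed.

Lemma derive_coef (t : R) k : 0 <= t ->
  derive_on half_line (coef dot e u k) t = dot (u' t) (e k).
Proof. by move=> t0; apply: derive_on_eq => //; exact: coef_diff_quot. Qed.

(** The difference quotient of |A^(1/2) u|^2 factors, by [power_half_sqB],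
    into the difference quotient of [u], which converges in D(A^(1/4)), and
    u(s) + u(t), which converges in D(A^(3/4)). *)
Lemma potential_diff_quot (t : R) : 0 <= t ->
  diff_quot (fun t => `|Apow (1 / 2) (u t)| ^+ 2 : R^o) t s
    @[s --> within half_line t^'] -->
  (2 * dot (Apow (1 / 4) (u' t)) (Apow (3 / 4) (u t)) : R^o).
Proof.
move=> t0; have [_ h] := diff_quot_cvg t0.
have [_ c] := C0_cvg u_C0 t0.
have c' : Apow (3 / 4) (u s) @[s --> within half_line t^'] --> Apow (3 / 4) (u t).
  exact: cvg_trans (cvg_app _ (@within_dnbhs_le R t)) c.
have lim : dot (Apow (1 / 4) (diff_quot u t s))
    (Apow (3 / 4) (u s) + Apow (3 / 4) (u t)) @[s --> within half_line t^'] -->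
    2 * dot (Apow (1 / 4) (u' t)) (Apow (3 / 4) (u t)).
  rewrite [X in _ --> X](_ : _ =
    dot (Apow (1 / 4) (u' t)) (Apow (3 / 4) (u t) + Apow (3 / 4) (u t))).
    by apply: cvg_dot => //; apply: cvgD => //; exact: cvg_cst.
  by rewrite dotDr; ring.
apply: cvg_trans lim; apply: near_eq_cvg.
apply: near_half_line => s s0.
have usD := uD s0; have utD := uD t0.
have BD : D (1 / 4) (u s - u t) by apply: power_domB => //; exact: uD14.
rewrite /diff_quot (power_half_sqB usD utD) (power_opZ H_hilbert e_basis _ BD).
by rewrite (power_opD H_hilbert e_basis usD utD) dotZl.
Qed.

Let cvg_normsq (F : set_system R) (FF : Filter F) (g : R -> H) (l : H) :
  g @ F --> l -> `|g s| ^+ 2 @[s --> F] --> `|l| ^+ 2.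
Proof. by move=> gl; apply: (cvgM (cvg_norm gl) (cvg_norm gl)). Qed.

Theorem kirchhoff_modal_flow (mm : R -> R) :
  (forall x : R, 0 <= x -> {for x, continuous mm}) ->
  (forall x, 0 <= x -> mm x = m x) ->
  (forall k t, half_line t ->
     let uk := coef dot e u k in
     [/\ derivable_on half_line uk t,
         derivable_on half_line (derive_on half_line uk) t &
         derive_on half_line (derive_on half_line uk) t
           + speed dot e lam m u t * lam k ^+ 2 * uk t = 0]) ->
  modal_flow lam mm
    (fun k t => dot (u (Num.max 0 t)) (e k))
    (fun k t => dot (u' (Num.max 0 t)) (e k))
    (fun t => `|Apow (1 / 2) (u (Num.max 0 t))| ^+ 2)
    (fun t => 2 * dot (Apow (1 / 4) (u' (Num.max 0 t)))
                      (Apow (3 / 4) (u (Num.max 0 t))))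
    (fun t => `|u' (Num.max 0 t)| ^+ 2)
    (fun t => `|Apow (1 / 4) (u' (Num.max 0 t))| ^+ 2 +
       mm (`|Apow (1 / 2) (u (Num.max 0 t))| ^+ 2) *
       `|Apow (3 / 4) (u (Num.max 0 t))| ^+ 2).
Proof.
move=> cmm mmE ode.
have M0 t : 0 <= Num.max 0 t :> R by rewrite le_max lexx.
have M_id (t : R) : 0 <= t -> Num.max 0 t = t by move=> t0; rewrite max_r.
have [_ u'C _] := u_C1.
have pc (t : R) : 0 <= t ->
    `|Apow (1 / 2) (u s)| ^+ 2 @[s --> within half_line (nbhs t)] -->
    `|Apow (1 / 2) (u t)| ^+ 2.
  move=> t0; apply: (@diff_quot_continuous R R^o
    (fun t => `|Apow (1 / 2) (u t)| ^+ 2)).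
  exact: potential_diff_quot.
split.
- move=> k t t0; apply: (is_derive_half_line (f := coef dot e u k)) => //.
    by move=> s s0; rewrite M_id.
  by rewrite M_id ?(ltW t0)//; apply: coef_diff_quot; exact: ltW.
- move=> k t t0.
  apply: (is_derive_half_line (f := derive_on half_line (coef dot e u k))) => //.
    by move=> s s0; rewrite M_id// derive_coef.
  rewrite M_id ?(ltW t0)//.
  have t0' : half_line t by rewrite half_lineE ltW.
  have /= [_ d2 eqn] := ode k t t0'.
  have -> : - (mm (`|Apow (1 / 2) (u t)| ^+ 2) * lam k ^+ 2 * dot (u t) (e k)) =
      derive_on half_line (derive_on half_line (coef dot e u k)) t.
    apply/esym/eqP; rewrite -addr_eq0 mmE ?sqr_ge0//; exact/eqP.
  exact: derivable_on_cvg.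
- move=> t t0.
  apply: (is_derive_half_line (f := fun t => `|Apow (1 / 2) (u t)| ^+ 2)) => //.
    by move=> s s0; rewrite M_id.
  by rewrite M_id ?(ltW t0)//; apply: potential_diff_quot; exact: ltW.
- move=> k; apply: (@within_cvg_continuous R R^o (fun t => dot (u t) (e k))) => t t0.
  apply: cvg_dot => //; last exact: cvg_cst.
  by have [] := C0_cvg u_C0 t0.
- move=> k; apply: (@within_cvg_continuous R R^o (fun t => dot (u' t) (e k))) => t t0.
  apply: cvg_dot => //; last exact: cvg_cst.
  by have [] := C0_cvg u'C t0.
- exact: (@within_cvg_continuous R R^o (fun t => `|Apow (1 / 2) (u t)| ^+ 2)).
- apply: (@within_cvg_continuous R R^o (fun t => `|Apow (1 / 4) (u' t)| ^+ 2 +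
    mm (`|Apow (1 / 2) (u t)| ^+ 2) * `|Apow (3 / 4) (u t)| ^+ 2)) => t t0.
  have [_ c1] := C0_cvg u'C t0; have [_ c2] := C0_cvg u_C0 t0.
  apply: cvgD; first exact: cvg_normsq.
  apply: cvgM; last exact: cvg_normsq.
  by apply: (cvg_comp _ mm (pc t t0)); apply: cmm; exact: sqr_ge0.
- move=> t; have := power_op_sq H_hilbert e_basis (power_dom_le _ _ (uD (M0 t))).
  move=> /(_ (1 / 2)); rewrite (@series_powR _ 2); last by field.
  by apply; lra.
- move=> t.
  have := power_quarter_threequarter (u'D (M0 t)) (uD (M0 t)).
  move=> h; set f := (X in series X @ _ --> _) in h.
  rewrite [X in X @ _ --> _](_ : _ = fun n => 2 * series f n).
    by apply: cvgM => //; exact: cvg_cst.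
  apply/funext => n; rewrite -seriesMl.
  by apply: eq_bigr => k _; rewrite /f (dotC dot (u _)); ring.
- by move=> t; exact: parseval_sq.
- move=> t.
  have h1 := power_op_sq H_hilbert e_basis (u'D (M0 t)).
  have h2 := power_op_sq H_hilbert e_basis (uD (M0 t)).
  rewrite (@series_powR _ 1) in h1; last by field.
  rewrite (@series_powR _ 3) in h2; last by field.
  set c := mm _; set f := (X in series X @ _ --> _) in h1.
  set g := (X in series X @ _ --> _) in h2.
  rewrite [X in X @ _ --> _](_ : _ = fun n => series f n + c * series g n).
    by apply: cvgD => //; apply: cvgM => //; exact: cvg_cst.
  apply/funext => n; rewrite -seriesMl /series/= -big_split/=.
  by apply: eq_bigr => k _; rewrite /modal_energy /f /g /c; ring.
Qed.

End Kirchhoff.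

(** * Linear and quasi-analytic weights *)

Section Weights.
Context {R : realType}.

Definition quasi_analytic_weight (sigma : R) : R := sigma / ln (2 + sigma).
Local Notation qa := quasi_analytic_weight.

Lemma ln_ge_half (x : R) : 2 <= x -> 1 / 2 <= ln x.
Proof.
move=> x2; have x0 : 0 < x by lra.
have : ln (1 + - (1 / 2)) <= - (1 / 2) :> R by apply: le_ln1Dx; lra.
rewrite (_ : 1 + - (1 / 2) = 2^-1 :> R); last by field.
rewrite lnV ?posrE// lerN2 => /le_trans; apply.
by rewrite ler_ln ?posrE.
Qed.

Lemma ln2_le1 : ln 2 <= 1 :> R.
Proof. by rewrite (_ : 2 = 1 + 1)//; apply: le_ln1Dx; lra. Qed.

(** By the tangent to the logarithm at 2 + x, it suffices that x / (2 + x) <=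
    ln (2 + x). *)
Lemma quasi_analytic_nondecreasing (x y : R) : 0 <= x -> x <= y -> qa x <= qa y.
Proof.
move=> x0 xy.
have lnx := ln_ge_half (x := 2 + x); have lny := ln_ge_half (x := 2 + y).
rewrite /qa ler_pdivrMr; last by apply: lt_le_trans (lnx _); lra.
rewrite mulrAC ler_pdivlMr; last by apply: lt_le_trans (lny _); lra.
have dx : 0 < 2 + x by lra.
have h1 : ln (2 + y) <= ln (2 + x) + (y - x) / (2 + x).
  rewrite -lerBlDl -ln_div ?posrE//; last by lra.
  rewrite (_ : (2 + y) / (2 + x) = 1 + (y - x) / (2 + x)).
    apply: le_ln1Dx; apply: lt_le_trans (_ : 0 <= _); first by lra.
    by rewrite divr_ge0//; lra.
  by field; lra.
have h2 : x / (2 + x) <= ln (2 + x).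
  have : ln (1 + ((2 + x)^-1 - 1)) <= (2 + x)^-1 - 1.
    by apply: le_ln1Dx; rewrite ltrBrDr addNr invr_gt0.
  rewrite addrC subrK lnV ?posrE// lerNl opprB => h; apply: le_trans h.
  rewrite ler_pdivrMr// mulrBl mul1r mulVf ?gt_eqF//; lra.
apply: le_trans (ler_wpM2l x0 h1) _.
rewrite mulrDr [x * ((y - x) / _)](_ : _ = (y - x) * (x / (2 + x))); last by ring.
have h3 : (y - x) * (x / (2 + x)) <= (y - x) * ln (2 + x).
  by apply: ler_wpM2l => //; rewrite subr_ge0.
by lra.
Qed.

(** An upper bound for the inverse function of the weight, which has no closed
    form. *)
Definition quasi_analytic_threshold (x : R) : R := 5 * (2 + x) * ln (2 + x).

Lemma quasi_analytic_threshold_ge0 (x : R) : 0 <= x ->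
  0 <= quasi_analytic_threshold x.
Proof.
move=> x0; have := ln_ge_half (x := 2 + x) => h.
by rewrite !mulr_ge0//; [lra|apply: le_trans (h _); lra].
Qed.

Lemma quasi_analytic_threshold_le (x : R) : 0 <= x ->
  quasi_analytic_threshold x <= 5 * (2 + x) ^+ 2.
Proof.
move=> x0; rewrite /quasi_analytic_threshold -mulrA ler_wpM2l// expr2.
by rewrite ler_wpM2l ?ltW// ?ln_sublinear//; lra.
Qed.

(** For X = 2 + x >= 2 one has 2 + 5 X ln X <= 6 X^2 <= X^5, so that the
    logarithm in the denominator of the weight is at most 5 ln X. *)
Lemma quasi_analytic_thresholdP (x : R) : 0 <= x ->
  x <= qa (quasi_analytic_threshold x).
Proof.
move=> x0; set mu := quasi_analytic_threshold x.
have mu0 : 0 <= mu := quasi_analytic_threshold_ge0 x0.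
have muX : mu <= 5 * (2 + x) ^+ 2 := quasi_analytic_threshold_le x0.
have lnmu : 1 / 2 <= ln (2 + mu) by apply: ln_ge_half; lra.
rewrite /qa ler_pdivlMr; last by lra.
have lnX : 1 / 2 <= ln (2 + x) by apply: ln_ge_half; lra.
have h : ln (2 + mu) <= 5 * ln (2 + x).
  rewrite mulr_natl -lnXn; last by lra.
  rewrite ler_ln ?posrE ?exprn_gt0//; [|lra|lra].
  apply: (@le_trans _ _ (6 * (2 + x) ^+ 2)).
    by move: muX; rewrite !expr2; nra.
  rewrite (_ : (2 + x) ^+ 5 = (2 + x) ^+ 3 * (2 + x) ^+ 2); last by ring.
  rewrite ler_wpM2r ?sqr_ge0//.
  have -> : (2 + x) ^+ 3 = 8 + x * (12 + 6 * x + x ^+ 2) by ring.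
  have : 0 <= x * (12 + 6 * x + x ^+ 2).
    by rewrite mulr_ge0// !addr_ge0// ?sqr_ge0// mulr_ge0.
  by lra.
apply: le_trans (ler_wpM2l x0 h) _; rewrite /mu /quasi_analytic_threshold.
by nra.
Qed.

(** The base x is replaced by 2 + x, whose logarithm is positive and is the
    one that occurs in the quasi-analytic weight. *)
Lemma powR_le_expR (phi : R -> R) (al c : R) : 0 <= al ->
  (forall x, 0 <= x -> al * ln (2 + x) <= c + phi x / 2) ->
  forall x, 0 <= x -> x `^ al <= expR c * expR (phi x / 2).
Proof.
move=> al0 h x x0; apply: (@le_trans _ _ ((2 + x) `^ al)).
  by apply: ge0_ler_powR; rewrite ?nnegrE//; lra.
rewrite /powR gt_eqF; last by lra.
by rewrite -expRD ler_expR; exact: h.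
Qed.

Lemma powR_le_linear_weight (r al : R) : 0 < r -> 0 <= al ->
  exists2 K : R, 0 < K &
    forall x, 0 <= x -> x `^ al <= K * expR (r * x / 2).
Proof.
move=> r0 al0; exists (expR (r / 2 + al ^+ 2 / r)); first exact: expR_gt0.
apply: (powR_le_expR (phi := fun x => r * x)) => // x x0.
set s := ln (2 + x).
have s0 : 0 <= s by apply: ln_ge0; lra.
have h : 1 + s ^+ 2 / 2 <= 2 + x.
  rewrite -[leRHS](@lnK R) ?posrE; last by lra.
  by have := expR_ge1Dxn 1 s0.
(* al s is at most r s^2 / 4 + al^2 / r, and s^2 / 2 is at most 1 + x. *)
have sq : 0 <= (r * s / 2 - al) ^+ 2 / r by rewrite divr_ge0 ?sqr_ge0// ltW.
have eq : (r * s / 2 - al) ^+ 2 / r = r * s ^+ 2 / 4 - al * s + al ^+ 2 / r.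
  by field; lra.
rewrite eq in sq.
have : r * (1 + s ^+ 2 / 2) <= r * (2 + x) by rewrite ler_wpM2l// ltW.
by lra.
Qed.

Lemma powR_le_quasi_analytic_weight (al : R) : 0 <= al ->
  exists2 K : R, 0 < K &
    forall x, 0 <= x -> x `^ al <= K * expR (qa x / 2).
Proof.
move=> al0; exists (expR (1 + 3 * al ^+ 2)); first exact: expR_gt0.
apply: powR_le_expR => // x x0; rewrite /qa.
have s2 : 1 / 2 <= ln (2 + x) by apply: ln_ge_half; lra.
have h : 1 + ln (2 + x) ^+ 3 / 6 <= 2 + x.
  rewrite -[leRHS](@lnK R) ?posrE; last by lra.
  by have := @expR_ge1Dxn R _ 2 (le_trans _ s2); apply; lra.
move: (ln (2 + x)) s2 h => s s2 h; have s0 : 0 < s by lra.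
have : s ^+ 2 / 6 - 2 <= x / s.
  rewrite ler_pdivlMr//.
  rewrite (_ : (s ^+ 2 / 6 - 2) * s = s ^+ 3 / 6 - 2 * s); last by field.
  by lra.
(* al s is at most s^2 / 12 + 3 al^2, while x / s is at least s^2 / 6 - 2. *)
have : 0 <= (s - 6 * al) ^+ 2 by exact: sqr_ge0.
by rewrite sqrrB exprMn; lra.
Qed.

End Weights.

(** * Differential inequalities and frequency cuts *)

Section Comparison.
Context {R : realType}.

Lemma linear_comparison (L dL : R -> R) (b : R) :
  L 0 = 0 ->
  (forall t : R, 0 <= t -> is_derive t 1 L (dL t)) ->
  (forall t, 0 <= t -> dL t <= b * (1 + L t)) ->
  forall t, 0 <= t -> 1 + L t <= expR (b * t).
Proof.
move=> L0 LE dLb t t0.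
have dX (s : R) : 0 <= s -> is_derive s 1 (fun s => 1 + L s) (dL s).
  by move=> s0; have := LE s s0 => dLs; rewrite -[dL s]add0r; apply: is_deriveD.
have db (s : R) : is_derive s 1 (fun s => b * s) b.
  by apply: (is_derive_eq (is_deriveZ b (is_derive_id s (1 : R)))); exact: mulr1.
have := @gronwall R (fun s => 1 + L s) dL (fun s => b * s) (fun=> b) t t0.
rewrite L0 addr0 mul1r mulr0 subr0; apply => s /andP[s0 st].
- exact: is_derive_continuous (dX s s0).
- exact: is_derive_continuous (db s).
- by apply: dX; exact: ltW.
- by apply: dLb; exact: ltW.
Qed.

(** The logarithm of 2 + L satisfies a linear differential inequality, with
    initial value ln 2 <= 1. *)
Lemma quasi_linear_comparison (L dL : R -> R) (b : R) :
  L 0 = 0 ->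
  (forall t, 0 <= t -> 0 <= L t) ->
  (forall t : R, 0 <= t -> is_derive t 1 L (dL t)) ->
  (forall t, 0 <= t -> dL t <= b * ((2 + L t) * ln (2 + L t))) ->
  forall t, 0 <= t -> 2 + L t <= expR (expR (b * t)).
Proof.
move=> L0 Lge0 LE dLb t t0.
have X0 s : 0 <= s -> 0 < 2 + L s by move=> /Lge0; lra.
have dX (s : R) : 0 <= s ->
    is_derive s 1 (fun s => ln (2 + L s)) ((2 + L s)^-1 * dL s).
  move=> s0; have := LE s s0 => dLs.
  have d2L : is_derive s 1 (fun s => 2 + L s) (dL s).
    by rewrite -[dL s]add0r; apply: is_deriveD.
  have dln := is_derive1_ln (X0 s s0).
  exact: (is_derive1_comp (f := @ln R) (g := fun s => 2 + L s)).
have db (s : R) : is_derive s 1 (fun s => b * s) b.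
  by apply: (is_derive_eq (is_deriveZ b (is_derive_id s (1 : R)))); exact: mulr1.
have : ln (2 + L t) <= ln 2 * expR (b * t).
  have := @gronwall R (fun s => ln (2 + L s)) (fun s => (2 + L s)^-1 * dL s)
    (fun s => b * s) (fun=> b) t t0.
  rewrite L0 addr0 mulr0 subr0; apply => s /andP[s0 st].
  - exact: is_derive_continuous (dX s s0).
  - exact: is_derive_continuous (db s).
  - by apply: dX; exact: ltW.
  - rewrite ler_pdivrMl ?X0 ?(ltW s0)// mulrCA.
    by apply: dLb; exact: ltW.
rewrite -ler_expR lnK ?posrE ?X0// => /le_trans; apply; rewrite ler_expR.
by rewrite -[leRHS]mul1r ler_wpM2r ?expR_ge0// ln2_le1.
Qed.

End Comparison.

(** The frequency cut. Each term is bounded by a sum of two, so that no index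
    set has to be split: in the applications the first summand suffices for a
    low mode and the second for a high one. *)
Lemma low_high_split (R : realType) (a b w : nat -> R) (W G A B : R) n :
  0 <= W -> 0 <= G -> (forall k, w k * a k <= W * a k + G * b k) ->
  series a n <= A -> series b n <= B ->
  series (fun k => w k * a k) n <= W * A + G * B.
Proof.
move=> W0 G0 split aA bB.
apply: (@le_trans _ _ (W * series a n + G * series b n)).
  by rewrite /series/= !mulr_sumr -big_split/=; exact: ler_sum.
by apply: lerD; exact: ler_wpM2l.
Qed.

Section GevreyControl.
Context {R : realType} (lam : nat -> R) (a : nat -> R -> R).
Context (phi T : R -> R) (S L : R -> R) (E0 C F0 : R).
Hypotheses (lam_ge0 : forall k, 0 <= lam k) (C_gt0 : 0 < C).
Hypothesis a_ge0 : forall k t, 0 <= t -> 0 <= a k t.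
Hypothesis phi_nondecreasing : forall x y, 0 <= x -> x <= y -> phi x <= phi y.
Hypothesis T_ge0 : forall x, 0 <= x -> 0 <= T x.
Hypothesis TP : forall x, 0 <= x -> x <= phi (T x).
Hypothesis L0 : L 0 = 0.
Hypothesis dL : forall t : R, 0 <= t -> is_derive t 1 L (C * S t).
Hypothesis a_growth : forall k t, 0 <= t -> a k t <= a k 0 * expR (L t).
Hypothesis a_sum : forall t n, 0 <= t -> series (a ^~ t) n <= E0.
Hypothesis S_sum : forall t, 0 <= t ->
  series (fun k => lam k * a k t) @ \oo --> S t.
Hypothesis F0_sum : forall n,
  series (fun k => Num.max 1 (lam k) * a k 0 * expR (phi (lam k))) n <= F0.

Local Notation b k := (Num.max 1 (lam k) * a k 0 * expR (phi (lam k))).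

Let max_gt0 k : 0 < Num.max 1 (lam k). Proof. by rewrite lt_max ltr01. Qed.

Let b_ge0 k : 0 <= b k.
Proof. by rewrite !mulr_ge0 ?expR_ge0 ?a_ge0// ltW. Qed.

Lemma growth_exponent_ge0 t : 0 <= t -> 0 <= L t.
Proof.
move=> t0; rewrite -L0; apply: (deriv_ge0_le t0 (df := fun s => C * S s)).
- by move=> s /andP[s0 _]; exact: is_derive_continuous (dL s0).
- by move=> s /andP[/ltW s0 _]; exact: dL.
- move=> s /andP[/ltW s0 _]; rewrite mulr_ge0 ?(ltW C_gt0)//.
  have := @series_le_limit R _ _ 0 _ (S_sum s0).
  rewrite [series _ 0]/series/= big_geq//; apply=> k.
  by rewrite mulr_ge0 ?a_ge0.
Qed.

(** Above the frequency T(L(t)) the weight exp(phi) dominates the growth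
    factor exp(L(t)). *)
Lemma weighted_sum_le t : 0 <= t -> S t <= T (L t) * E0 + F0.
Proof.
move=> t0; have Lt := growth_exponent_ge0 t0.
apply: limit_le_bound (S_sum t0) _ => n; rewrite -[F0]mul1r.
apply: (low_high_split (b := fun k => b k)) => //.
- exact: T_ge0.
- move=> k; rewrite mul1r; have [le|/ltW gt] := leP (lam k) (T (L t)).
    by rewrite -[leLHS]addr0 lerD// ler_wpM2r// a_ge0.
  rewrite -[leLHS]add0r lerD//; first by rewrite mulr_ge0 ?T_ge0 ?a_ge0.
  rewrite -mulrA; apply: ler_pM => //; first exact: a_ge0.
    by rewrite le_max lexx orbT.
  apply: le_trans (a_growth k t0) _; rewrite ler_wpM2l ?a_ge0// ler_expR.
  by apply: le_trans (TP Lt) _; apply: phi_nondecreasing => //; exact: T_ge0.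
- exact: a_sum.
Qed.

(** Above the frequency T(2 L(t)) one half of phi dominates L(t); the other
    half dominates the power of the frequency. *)
Lemma moment_sum_le (al K : R) t n : 0 <= al -> 0 <= K ->
  (forall x, 0 <= x -> x `^ al <= K * expR (phi x / 2)) -> 0 <= t ->
  series (fun k => lam k `^ al * a k t) n <= T (2 * L t) `^ al * E0 + K * F0.
Proof.
move=> al0 K0 Kal t0; have Lt : 0 <= 2 * L t by have := growth_exponent_ge0 t0; lra.
apply: (low_high_split (b := fun k => b k)) => //.
- exact: powR_ge0.
- move=> k; have [le|/ltW gt] := leP (lam k) (T (2 * L t)).
    rewrite -[leLHS]addr0; apply: lerD; last exact: mulr_ge0.
    apply: ler_wpM2r; first exact: a_ge0.
    by apply: ge0_ler_powR; rewrite ?nnegrE// T_ge0.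
  rewrite -[leLHS]add0r lerD//; first by rewrite mulr_ge0 ?powR_ge0 ?a_ge0.
  have phiL : L t <= phi (lam k) / 2.
    have := TP Lt; have := phi_nondecreasing (T_ge0 Lt) gt; lra.
  apply: (@le_trans _ _
    ((K * expR (phi (lam k) / 2)) * (a k 0 * expR (phi (lam k) / 2)))).
    apply: ler_pM; rewrite ?powR_ge0 ?a_ge0//; first exact: Kal.
    apply: le_trans (a_growth k t0) _.
    by rewrite ler_wpM2l ?a_ge0// ler_expR.
  have -> : K * expR (phi (lam k) / 2) * (a k 0 * expR (phi (lam k) / 2)) =
      K * (a k 0 * (expR (phi (lam k) / 2) * expR (phi (lam k) / 2))) by ring.
  rewrite -expRD -splitr ler_wpM2l// -mulrA -[leLHS]mul1r ler_wpM2r//.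
    by rewrite mulr_ge0 ?a_ge0 ?expR_ge0.
  by rewrite le_max lexx.
- exact: a_sum.
Qed.

End GevreyControl.

(** * Estimates for the solution *)

Section KirchhoffEstimates.
Context {R : realType} {H : completeNormedModType R} (dot : {dot H for idfun}).
Context (e : nat -> H) (lam : nat -> R) (m : R -> R) (nu0 : R).
Hypotheses (H_hilbert : hilbert_dot dot) (e_basis : orthonormal_basis dot e).
Hypothesis lam_ge0 : forall k, 0 <= lam k.
Hypotheses (m_C1 : C1_real half_line m) (nu0_gt0 : 0 < nu0).
Hypothesis m_ge_nu0 : forall sigma, 0 <= sigma -> nu0 <= m sigma.
Context (u0 u1 : H) (u : R -> H).
Hypothesis u_sol : global_solution dot e lam m u0 u1 u.

Local Notation u' := (derive_on half_line u).
Local Notation a := (mode_energy dot e lam m u).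

(** With [m] extended to the whole line and time retracted to the half-line,
    the solution becomes a [modal_flow]. *)
Theorem kirchhoff_energy_estimate : exists (E0 C : R) (L S : R -> R),
  [/\ 0 < E0, 0 < C, L 0 = 0,
      (forall t : R, 0 <= t -> is_derive t 1 L (C * S t)) &
      forall t : R, 0 <= t ->
        [/\ forall k, a k t <= a k 0 * expR (L t),
            forall n, series (a ^~ t) n <= E0 &
            series (fun k => lam k * a k t) @ \oo --> S t]].
Proof.
have [u_C0 u_C1 ode _ _] := u_sol.
have [mm [dm [dm_cont mm_deriv mmE]]] := C1_extension m_C1.
have mm_cont (x : R) : 0 <= x -> {for x, continuous mm}.
  by move=> x0; exact: is_derive_continuous (mm_deriv x x0).
have mm_ge (x : R) : 0 <= x -> nu0 <= mm x by move=> x0; rewrite mmE// m_ge_nu0.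
have flow := kirchhoff_modal_flow H_hilbert e_basis lam_ge0 u_C0 u_C1 mm_cont
  mmE ode.
have [E0 [C [L [E0_gt0 C_gt0 L0 dL est]]]] :=
  modal_energy_estimate lam_ge0 nu0_gt0 mm_deriv dm_cont mm_ge flow.
exists E0, C, L; eexists; split; [exact: E0_gt0|exact: C_gt0|exact: L0|exact: dL|].
have aE t : 0 <= t -> forall k, a k t = modal_energy lam mm
    (fun k t => dot (u (Num.max 0 t)) (e k))
    (fun k t => dot (u' (Num.max 0 t)) (e k))
    (fun t => `|power_op dot e lam (1 / 2) (u (Num.max 0 t))| ^+ 2) k t.
  by move=> t0 k; rewrite /modal_energy max_r// mmE ?sqr_ge0.
move=> t t0; have [growth sum] := est t t0; split=> [k|n|].
- by rewrite !aE// growth.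
- by under eq_fun do rewrite aE//; exact: sum.
- under eq_fun do rewrite aE//.
  exact: (weighted_sum flow).
Qed.

Lemma mode_energy_ge k t :
  nu0 * (lam k ^+ 2 * dot (u t) (e k) ^+ 2) + dot (u' t) (e k) ^+ 2 <= a k t.
Proof.
rewrite addrC /mode_energy lerD2l -mulrA ler_wpM2r ?m_ge_nu0 ?sqr_ge0//.
by rewrite -exprMn sqr_ge0.
Qed.

Lemma mode_energy_ge0 k t : 0 <= a k t.
Proof.
apply: le_trans (mode_energy_ge k t); rewrite addr_ge0 ?sqr_ge0//.
by rewrite mulr_ge0 ?(ltW nu0_gt0)// -exprMn sqr_ge0.
Qed.

Lemma phi_energy_le (phi : R -> R) (t X : R) : 0 <= X ->
  (forall k, a k t <= a k 0 * X) ->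
  (phi_energy dot e lam m phi u t <= phi_energy dot e lam m phi u 0 * X%:E)%E.
Proof.
move=> X0 aX; have max_ge0 k : 0 <= Num.max 1 (lam k) by rewrite le_max ler01.
rewrite /phi_energy muleC -nneseriesZl; last first.
  by move=> k _; rewrite lee_fin !mulr_ge0 ?mode_energy_ge0 ?expR_ge0.
apply: lee_nneseries => [k _ _|k _].
  by rewrite lee_fin !mulr_ge0 ?mode_energy_ge0 ?expR_ge0.
rewrite -EFinM lee_fin mulrA ler_wpM2r ?expR_ge0// mulrCA ler_wpM2l//.
by rewrite mulrC.
Qed.

(** Modes with lam_k >= 1 are controlled by the two Gevrey sums; on the others
    exp(phi) is at most exp(phi(1)), and their total energy is finite. *)
Lemma gevrey_initial_energy (phi : R -> R) (E0 : R) :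
  (forall x y, 0 <= x -> x <= y -> phi x <= phi y) ->
  (forall n, series (a ^~ 0) n <= E0) ->
  gevrey dot e lam phi (3 / 4) u0 -> gevrey dot e lam phi (1 / 4) u1 ->
  exists2 F0 : R, 0 <= F0 & forall n,
    series (fun k => Num.max 1 (lam k) * a k 0 * expR (phi (lam k))) n <= F0.
Proof.
move=> phi_nd aE0 + +; have [_ _ _ u00 u'0] := u_sol.
have w_ge0 (al : R) z k : 0 <= lam k `^ (4 * al) * expR (phi (lam k)) *
    dot z (e k) ^+ 2.
  by rewrite mulr_ge0 ?sqr_ge0// mulr_ge0 ?powR_ge0 ?expR_ge0.
move=> /(nneseries_ltyP _)[//|B0 hB0] /(nneseries_ltyP _)[//|B1 hB1].
pose c := speed dot e lam m u 0.
have c_ge0 : 0 <= c.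
  by apply: le_trans (ltW nu0_gt0) _; rewrite m_ge_nu0 ?sqr_ge0.
have bound n : series (fun k => Num.max 1 (lam k) * a k 0 * expR (phi (lam k))) n
    <= expR (phi 1) * E0 + (B1 + c * B0).
  apply: (@le_trans _ _ (expR (phi 1) * series (a ^~ 0) n +
    (series (fun k => lam k `^ (4 * (1 / 4)) * expR (phi (lam k)) *
       dot u1 (e k) ^+ 2) n +
     c * series (fun k => lam k `^ (4 * (3 / 4)) * expR (phi (lam k)) *
       dot u0 (e k) ^+ 2) n))); last first.
    by rewrite lerD ?ler_wpM2l ?expR_ge0// lerD// ler_wpM2l.
  rewrite /series/= !mulr_sumr -!big_split/=; apply: ler_sum => k _.
  have -> : 4 * (1 / 4) = 1%:R :> R by field.
  have -> : 4 * (3 / 4) = 3%:R :> R by field.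
  rewrite !powR_mulrn//.
  have -> : lam k ^+ 1 * expR (phi (lam k)) * dot u1 (e k) ^+ 2 +
      c * (lam k ^+ 3 * expR (phi (lam k)) * dot u0 (e k) ^+ 2) =
      lam k * a k 0 * expR (phi (lam k)).
    by rewrite /mode_energy u00 u'0 -/c; ring.
  have [l1|l1] := leP 1 (lam k).
    by rewrite lerDr mulr_ge0 ?expR_ge0 ?mode_energy_ge0.
  rewrite mul1r -[leLHS]addr0 lerD ?mulr_ge0 ?expR_ge0 ?mode_energy_ge0//.
  rewrite mulrC ler_wpM2r ?mode_energy_ge0// ler_expR.
  by apply: phi_nd => //; exact: ltW.
eexists; last exact: bound.
by have := bound 0; rewrite {1}/series/= big_geq.
Qed.

Let kappa := 1 + nu0^-1.

Lemma moment_sobolev_bound (al t B : R) : 0 <= al ->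
  (forall n, series (fun k => lam k `^ (4 * al) * a k t) n <= B) ->
  sobolev_bound dot e lam al u t (kappa * B).
Proof.
move=> al0 sumB.
have powE k : lam k `^ (4 * (al + 1 / 2)) = lam k `^ (4 * al) * lam k ^+ 2.
  rewrite (_ : 4 * (al + 1 / 2) = 4 * al + 2%:R); last by field.
  rewrite powRD ?powR_mulrn//.
  by apply/implyP => /eqP h; exfalso; move: h; apply/eqP/lt0r_neq0; lra.
have w0 k : 0 <= lam k `^ (4 * al) := powR_ge0 _ _.
have uk0 k : 0 <= lam k ^+ 2 * dot (u t) (e k) ^+ 2 by rewrite -exprMn sqr_ge0.
have free k : dot (u' t) (e k) ^+ 2 + lam k ^+ 2 * dot (u t) (e k) ^+ 2
    <= kappa * a k t.
  have h := mode_energy_ge k t; have v0 := sqr_ge0 (dot (u' t) (e k)).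
  apply: le_trans (ler_wpM2l _ h); last by rewrite addr_ge0 ?invr_ge0// ltW.
  move: (uk0 k) v0.
  move: (lam k ^+ 2 * dot (u t) (e k) ^+ 2) (dot (u' t) (e k) ^+ 2) => w v w_ge0 v_ge0.
  have -> : kappa * (nu0 * w + v) = (v + w) + (nu0 * w + nu0^-1 * v).
    by rewrite /kappa; field; rewrite gt_eqF.
  by rewrite lerDl addr_ge0 ?mulr_ge0 ?invr_ge0// ltW.
pose f k := lam k `^ (4 * al) * dot (u' t) (e k) ^+ 2.
pose g k := lam k `^ (4 * (al + 1 / 2)) * dot (u t) (e k) ^+ 2.
have f0 k : 0 <= f k by rewrite mulr_ge0 ?sqr_ge0.
have g0 k : 0 <= g k by rewrite mulr_ge0 ?powR_ge0 ?sqr_ge0.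
have fgB n : series f n + series g n <= kappa * B.
  apply: le_trans (ler_wpM2l _ (sumB n)); last by rewrite addr_ge0 ?invr_ge0// ltW.
  rewrite /series/= mulr_sumr -big_split/=; apply: ler_sum => k _.
  by rewrite /f /g powE -mulrA -mulrDr [leRHS]mulrCA ler_wpM2l.
have series_ge0 (h : nat -> R) n : (forall k, 0 <= h k) -> 0 <= series h n.
  by move=> h0; apply: sumr_ge0 => k _.
have Du' : power_dom dot e lam al (u' t).
  apply/power_domP; exists (kappa * B) => n; apply: le_trans (fgB n).
  by rewrite lerDl series_ge0.
have Du : power_dom dot e lam (al + 1 / 2) (u t).
  apply/power_domP; exists (kappa * B) => n; apply: le_trans (fgB n).
  by rewrite lerDr series_ge0.
split=> //.
apply: (@limit_le_bound R (fun n => series f n + series g n)); last exact: fgB.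
by apply: cvgD; exact: power_op_sq.
Qed.

(** Here T(x) = x / r0, and 1 + L satisfies a linear differential inequality.
    As L <= exp(b t), the cut T(2 L) contributes exp(4 alpha b t) to the
    moments. *)
Theorem analytic_data_estimate (r0 : R) : 0 < r0 ->
  let phi := fun sigma : R => r0 * sigma in
  gevrey dot e lam phi (3 / 4) u0 -> gevrey dot e lam phi (1 / 4) u1 ->
  exists beta1 : R,
    [/\ 0 < beta1,
        (forall t : R, 0 <= t ->
           (phi_energy dot e lam m phi u t
             <= phi_energy dot e lam m phi u 0
                * (expR (expR (beta1 * t)))%:E)%E) &
        (forall alpha : R, 0 <= alpha ->
           exists2 B : R, 0 < B &
             forall t : R, 0 <= t ->
               sobolev_bound dot e lam alpha u t
                 (B * expR (4 * alpha * beta1 * t)))].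
Proof.
move=> r0_gt0 phi g0 g1.
have [E0 [C [L [S [E0_gt0 C_gt0 L0 dL est]]]]] := kirchhoff_energy_estimate.
have phi_nd x y : 0 <= x -> x <= y -> phi x <= phi y.
  by move=> _ xy; rewrite ler_wpM2l// ltW.
have growth k t : 0 <= t -> a k t <= a k 0 * expR (L t) by move=> /est[].
have asum t n : 0 <= t -> series (a ^~ t) n <= E0 by move=> /est[].
have Ssum t : 0 <= t -> series (fun k => lam k * a k t) @ \oo --> S t.
  by move=> /est[].
have [F0 F0_ge0 F0_sum] := gevrey_initial_energy phi_nd (asum 0 ^~ (lexx 0)) g0 g1.
have a_ge0 k t : 0 <= t -> 0 <= a k t by move=> _; exact: mode_energy_ge0.
pose T x := x / r0.
have T_ge0 x : 0 <= x -> 0 <= T x by move=> x0; rewrite divr_ge0// ltW.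
have TP x : 0 <= x -> x <= phi (T x).
  by move=> _; rewrite /phi /T mulrC divfK// gt_eqF.
have L_ge0 t : 0 <= t -> 0 <= L t.
  by move=> t0; apply: (growth_exponent_ge0 lam_ge0 C_gt0 a_ge0 L0 dL Ssum).
pose b := C * (E0 / r0 + F0) + 1.
have b_gt0 : 0 < b.
  by rewrite ltr_wpDl// mulr_ge0 ?(ltW C_gt0)// addr_ge0// divr_ge0// ltW.
have L_le t : 0 <= t -> 1 + L t <= expR (b * t).
  apply: (linear_comparison L0 dL) => {}t t0.
  have := weighted_sum_le lam_ge0 C_gt0 a_ge0 phi_nd T_ge0 TP L0 dL
    growth asum Ssum F0_sum t0.
  have Lt := L_ge0 t t0.
  rewrite /T (_ : L t / r0 * E0 = E0 / r0 * L t); last by ring.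
  move=> St.
  apply: le_trans (ler_wpM2l (ltW C_gt0) St) _.
  have q0 : 0 <= E0 / r0 by rewrite divr_ge0// ltW.
  have -> : b * (1 + L t) = C * ((E0 / r0 + F0) * (1 + L t)) + (1 + L t).
    by rewrite /b; ring.
  rewrite -[leLHS]addr0; apply: lerD; last by lra.
  by apply: (ler_wpM2l (ltW C_gt0)); nra.
exists b; split => // [t t0|al al0].
  apply: phi_energy_le; first exact: expR_ge0.
  move=> k; apply: le_trans (growth k t t0) _.
  rewrite ler_wpM2l ?mode_energy_ge0// ler_expR.
  by have := L_le t t0; lra.
have al4 : 0 <= 4 * al by rewrite mulr_ge0.
have [K K0 Kal] := powR_le_linear_weight r0_gt0 al4.
exists (kappa * ((2 / r0) `^ (4 * al) * E0 + K * F0)).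
  apply: mulr_gt0; first by rewrite addr_gt0 ?invr_gt0.
  apply: ltr_pwDl; last by rewrite mulr_ge0// ltW.
  by rewrite mulr_gt0// powR_gt0// divr_gt0.
move=> t t0; rewrite -(mulrA kappa); apply: moment_sobolev_bound => // n.
apply: le_trans (moment_sum_le lam_ge0 C_gt0 a_ge0 phi_nd T_ge0 TP L0 dL
  growth asum Ssum F0_sum n al4 (ltW K0) Kal t0) _.
rewrite (mulrDl (_ * E0)); apply: lerD; last first.
  rewrite -[leLHS]mulr1 ler_wpM2l ?mulr_ge0 ?(ltW K0)//.
  by rewrite -expR0 ler_expR !mulr_ge0// ltW.
rewrite [leRHS]mulrAC; apply: ler_wpM2r; first exact: ltW.
rewrite (_ : 4 * al * b * t = b * t * (4 * al)); last by ring.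
rewrite expRM -powRM ?expR_ge0 ?divr_ge0 ?(ltW r0_gt0)//.
apply: ge0_ler_powR; rewrite ?nnegrE ?T_ge0 ?mulr_ge0 ?L_ge0 ?expR_ge0//.
  by rewrite invr_ge0 ltW.
rewrite /T mulrAC ler_wpM2l ?divr_ge0 ?(ltW r0_gt0)//.
by have := L_le t t0; lra.
Qed.

(** Here 2 + L <= exp(exp(b t)) and T(2 L) <= 20 exp(2 y) with y = exp(b t),
    so that the moments are of the order of exp(8 alpha y). As 8 alpha y <= (4
    alpha)^2 + y^2, the rate 2 b suffices in the inner exponential, up to a
    constant factor. *)
Theorem quasi_analytic_data_estimate :
  let phi := @quasi_analytic_weight R in
  gevrey dot e lam phi (3 / 4) u0 -> gevrey dot e lam phi (1 / 4) u1 ->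
  exists beta2 : R,
    [/\ 0 < beta2,
        (forall t : R, 0 <= t ->
           (phi_energy dot e lam m phi u t
             <= phi_energy dot e lam m phi u 0
                * (expR (expR (expR (beta2 * t))))%:E)%E) &
        (forall alpha : R, 0 <= alpha ->
           exists2 B : R, 0 < B &
             forall t : R, 0 <= t ->
               sobolev_bound dot e lam alpha u t
                 (B * expR (expR (Num.max 2 (4 * alpha) * beta2 * t))))].
Proof.
move=> phi g0 g1.
have [E0 [C [L [S [E0_gt0 C_gt0 L0 dL est]]]]] := kirchhoff_energy_estimate.
have phi_nd x y : 0 <= x -> x <= y -> phi x <= phi y.
  exact: quasi_analytic_nondecreasing.
have growth k t : 0 <= t -> a k t <= a k 0 * expR (L t) by move=> /est[].
have asum t n : 0 <= t -> series (a ^~ t) n <= E0 by move=> /est[].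
have Ssum t : 0 <= t -> series (fun k => lam k * a k t) @ \oo --> S t.
  by move=> /est[].
have [F0 F0_ge0 F0_sum] := gevrey_initial_energy phi_nd (asum 0 ^~ (lexx 0)) g0 g1.
have a_ge0 k t : 0 <= t -> 0 <= a k t by move=> _; exact: mode_energy_ge0.
pose T := @quasi_analytic_threshold R.
have T_ge0 x : 0 <= x -> 0 <= T x := @quasi_analytic_threshold_ge0 R x.
have TP x : 0 <= x -> x <= phi (T x) := @quasi_analytic_thresholdP R x.
have L_ge0 t : 0 <= t -> 0 <= L t.
  by move=> t0; apply: (growth_exponent_ge0 lam_ge0 C_gt0 a_ge0 L0 dL Ssum).
pose b := C * (5 * E0 + F0) + 1.
have b_gt0 : 0 < b.
  by rewrite ltr_wpDl// mulr_ge0 ?(ltW C_gt0)// addr_ge0// mulr_ge0// ltW.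
have L_le t : 0 <= t -> 2 + L t <= expR (expR (b * t)).
  apply: (quasi_linear_comparison L0 L_ge0 dL) => {}t t0.
  have := weighted_sum_le lam_ge0 C_gt0 a_ge0 phi_nd T_ge0 TP L0 dL
    growth asum Ssum F0_sum t0.
  have Lt := L_ge0 t t0.
  have ln2L : 1 / 2 <= ln (2 + L t) by apply: ln_ge_half; lra.
  rewrite /T /quasi_analytic_threshold -(mulrA 5) => St.
  apply: le_trans (ler_wpM2l (ltW C_gt0) St) _.
  have : 1 <= (2 + L t) * ln (2 + L t) by nra.
  move: (_ * ln _) => X X1.
  have -> : b * X = C * ((5 * E0 + F0) * X) + X by rewrite /b; ring.
  rewrite -[leLHS]addr0; apply: lerD; last by lra.
  by apply: (ler_wpM2l (ltW C_gt0)); nra.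
exists b; split => // [t t0|al al0].
  apply: phi_energy_le; first exact: expR_ge0.
  move=> k; apply: le_trans (growth k t t0) _.
  rewrite ler_wpM2l ?mode_energy_ge0// ler_expR.
  by have := L_le t t0; lra.
have al4 : 0 <= 4 * al by rewrite mulr_ge0.
have [K K0 Kal] := powR_le_quasi_analytic_weight al4.
pose c := 20 `^ (4 * al) * expR ((4 * al) ^+ 2).
have c0 : 0 < c by rewrite mulr_gt0 ?powR_gt0 ?expR_gt0.
exists (kappa * (c * E0 + K * F0)).
  apply: mulr_gt0; first by rewrite addr_gt0 ?invr_gt0.
  apply: ltr_pwDl; last by rewrite mulr_ge0// ltW.
  by rewrite mulr_gt0.
move=> t t0; rewrite -(mulrA kappa); apply: moment_sobolev_bound => // n.
apply: le_trans (moment_sum_le lam_ge0 C_gt0 a_ge0 phi_nd T_ge0 TP L0 dL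
  growth asum Ssum F0_sum n al4 (ltW K0) Kal t0) _.
set X := expR (expR _).
have X1 : 1 <= X by rewrite /X -[leLHS]expR0 ler_expR expR_ge0.
rewrite (mulrDl (c * E0)); apply: lerD; last first.
  by rewrite -[leLHS]mulr1 ler_wpM2l ?mulr_ge0 ?(ltW K0).
rewrite [leRHS]mulrAC; apply: ler_wpM2r; first exact: ltW.
have Lt := L_ge0 t t0.
set y := expR (b * t).
have TL : T (2 * L t) <= 20 * expR (2 * y).
  apply: le_trans (quasi_analytic_threshold_le _) _; first by lra.
  have -> : expR (2 * y) = expR y ^+ 2 by rewrite -expRM_natl.
  have : 2 + 2 * L t <= 2 * expR y by have := L_le t t0; rewrite -/y; lra.
  have : 0 <= 2 + 2 * L t by lra.
  move: (2 + 2 * L t) (expR y) => p q p0 pq; rewrite !expr2; nra.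
apply: le_trans (ge0_ler_powR al4 _ _ TL) _.
- by rewrite nnegrE; apply: T_ge0; lra.
- by rewrite nnegrE mulr_ge0 ?expR_ge0.
rewrite powRM ?expR_ge0// /c -[leRHS]mulrA ler_wpM2l ?powR_ge0//.
rewrite -expRM /X -expRD ler_expR.
(* The inner exponential needs the rate 2 b even for small alpha. *)
have y2 : y ^+ 2 <= expR (Num.max 2 (4 * al) * b * t).
  rewrite /y -expRM_natl ler_expR mulrA ler_wpM2r// ler_wpM2r ?(ltW b_gt0)//.
  by rewrite le_max lexx.
apply: le_trans (lerD (lexx _) y2).
by have := sqr_ge0 (4 * al - y); rewrite sqrrB; lra.
Qed.

End KirchhoffEstimates.

Theorem theorem2p5 (R : realType) (H : completeNormedModType R)
    (dot : {dot H for idfun}) (DA : set H) (A : H -> H)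
    (e : nat -> H) (lam : nat -> R) (m : R -> R) (nu0 : R)
    (H_hilbert : hilbert_dot dot)
    (A_self_adjoint : self_adjoint dot DA A)
    (e_basis : orthonormal_basis dot e)
    (lam_ge0 : forall k, 0 <= lam k)
    (A_diag : forall k, DA (e k) /\ A (e k) = lam k ^+ 2 *: e k)
    (m_C1 : C1_real half_line m)
    (nu0_gt0 : 0 < nu0)
    (m_ge_nu0 : forall sigma, 0 <= sigma -> nu0 <= m sigma) :
  (forall r0 : R, 0 < r0 ->
     let phi := fun sigma : R => r0 * sigma in
     forall u0 u1 : H,
       gevrey dot e lam phi (3 / 4) u0 -> gevrey dot e lam phi (1 / 4) u1 ->
     forall u : R -> H, global_solution dot e lam m u0 u1 u ->
     exists beta1 : R,
       [/\ 0 < beta1,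
           (forall t : R, 0 <= t ->
              (phi_energy dot e lam m phi u t
                <= phi_energy dot e lam m phi u 0
                   * (expR (expR (beta1 * t)))%:E)%E) &
           (forall alpha : R, 0 <= alpha ->
              exists2 B : R, 0 < B &
                forall t : R, 0 <= t ->
                  sobolev_bound dot e lam alpha u t
                    (B * expR (4 * alpha * beta1 * t)))])
  /\
  (let phi := fun sigma : R => sigma / ln (2 + sigma) in
   forall u0 u1 : H,
     gevrey dot e lam phi (3 / 4) u0 -> gevrey dot e lam phi (1 / 4) u1 ->
   forall u : R -> H, global_solution dot e lam m u0 u1 u ->
   exists beta2 : R,
     [/\ 0 < beta2,
         (forall t : R, 0 <= t ->
            (phi_energy dot e lam m phi u t
              <= phi_energy dot e lam m phi u 0
                 * (expR (expR (expR (beta2 * t))))%:E)%E) &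
         (forall alpha : R, 0 <= alpha ->
            exists2 B : R, 0 < B &
              forall t : R, 0 <= t ->
                sobolev_bound dot e lam alpha u t
                  (B * expR (expR (Num.max 2 (4 * alpha) * beta2 * t))))]).
Proof.
split=> [r0 r0_gt0 phi u0 u1 g0 g1 u u_sol|phi u0 u1 g0 g1 u u_sol].
  exact: (analytic_data_estimate H_hilbert e_basis lam_ge0 m_C1 nu0_gt0 m_ge_nu0
    u_sol r0_gt0 g0 g1).
exact: (quasi_analytic_data_estimate H_hilbert e_basis lam_ge0 m_C1 nu0_gt0
  m_ge_nu0 u_sol g0 g1).
Qed.
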